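(* Assume that $\mathcal{O}$ has residue field of characteristic $p>2$, let $N\ge2$, and let $r=2l-1$ with $l\ge2$, $l'=l-1$. Let $\chi$ be a super stable irreducible complex character of $G_r=\mathrm{GL}_N(\mathcal{O}_r)$ above an irreducible character $\sigma$ of $K^{l'}$ (i.e. $\sigma$ is a constituent of $\chi|_{K^{l'}}$). Then: (1) $\sigma$ extends to a character $\tilde\sigma$ of the stabilizer $G_r(\sigma)$ of $\sigma$ in $G_r$. (2) There is an irreducible character $\rho$ of $G_r(\sigma)/K^{l'}$ (viewed by inflation as a character of $G_r(\sigma)$) such that $\chi=\mathrm{Ind}_{G_r(\sigma)}^{G_r}(\tilde\sigma\,\rho)$.
   Context: Rings. $\mathcal{O}$ is the ring of integers of a non-Archimedean local field $F$ (so $\mathcal{O}$ is a complete discrete valuation ring with finite residue field), $\mathfrak{p}$ its maximal ideal, $\pi$ a fixed generator of $\mathfrak{p}$, $k=\mathcal{O}/\mathfrak{p}=\mathbb{F}_q$ of characteristic $p$, and $\mathcal{O}_s=\mathcal{O}/\mathfrak{p}^s$ for $s\ge1$; $\mathfrak{g}_s=\mathrm{M}_N(\mathcal{O}_s)$. $\mu:k\to\mathcal{O}$ is the multiplicative section of the reduction map $\mathcal{O}\to k$ (so $\mu(ab)=\mu(a)\mu(b)$), and $\mu_s:k\to\mathcal{O}_s$ is its composite with $\mathcal{O}\to\mathcal{O}_s$; it is applied entrywise to matrices. Bars denote reduction mod $\mathfrak{p}$. Groups. $K^i=\ker(\mathrm{GL}_N(\mathcal{O}_r)\to \mathrm{GL}_N(\mathcal{O}_i))=I+\mathfrak{p}^i\mathfrak{g}_r$.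 The stabilizer in $G_r$ of a character $\theta$ of a normal subgroup $K$ is $G_r(\theta)=\{g\in G_r:\theta(gxg^{-1})=\theta(x)\ \forall x\in K\}$. Characters. Fix an additive character $\psi:F\to\mathbb{C}^\times$ trivial on $\mathcal{O}$ but not on $\mathfrak{p}^{-1}$. For $M\in\mathfrak{g}_{l'}$ put $\psi_M(I+\pi^l x)=\psi(\pi^{-l'}\mathrm{tr}(Mx))$, an irreducible character of $K^l$ (computed with any lifts to $\mathcal{O}$). The map $I+\pi^{l'}x\mapsto\bar x$ induces $K^{l'}/K^l\cong\mathrm{M}_N(k)$, and $B_M((I+\pi^{l'}x)K^l,(I+\pi^{l'}y)K^l)=\mathrm{tr}(\bar M(\bar x\bar y-\bar y\bar x))$ is an alternating bilinear form on $K^{l'}/K^l$ with values in $\mathbb{F}_q$. Let $J_M$ be a subgroup with $K^l\subseteq J_M\subseteq K^{l'}$ such that $J_M/K^l$ is a maximal isotropic subspace for $B_M$. For $\hat M\in\mathfrak{g}_l$ with $\hat M\equiv M \bmod \pi^{l'}$, the formula $\psi_{\hat M}(I+\pi^{l'}x)=\psi\big(\pi^{-l}\,\mathrm{tr}(\hat M(x-\tfrac12\pi^{l'}x^2))\big)$ defines a character of $J_M$ extending $\psi_M$ (here $p>2$), and $\mathrm{Ind}_{J_M}^{K^{l'}}(\psi_{\hat M})$ is irreducible and independent of the choice of $J_M$. Jordan canonical form. Over a ring $R$, $J_n(\lambda)$ is the $n\times n$ matrix with all diagonal entries $\lambda\in R$, entries just above the diagonal equal to $1$, and all other entries $0$.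 A matrix over $R$ is in Jordan canonical form if it is block-diagonal with each diagonal block of the form $J_n(\lambda)$. Stable matrices. $M\in\mathfrak{g}_s$ is stable if, possibly after passing to an unramified extension $\hat{\mathcal{O}}_s$ of $\mathcal{O}_s$ (i.e. $\hat{\mathcal{O}}_s=\hat{\mathcal{O}}/\pi^s\hat{\mathcal{O}}$ with $\hat{\mathcal{O}}$ the ring of integers of a finite unramified extension of $F$), $M$ is conjugate under $\mathrm{GL}_N(\hat{\mathcal{O}}_s)$ to a matrix $A+\pi B$ with entries in $\hat{\mathcal{O}}_s$ such that $A$ is in Jordan canonical form, $A=\hat\mu_s(\bar A)$ (where $\hat\mu_s$ is the multiplicative section for $\hat{\mathcal{O}}_s$, applied entrywise), and $B\in Z(C_{\mathrm{M}_N(\hat{\mathcal{O}}_s)}(A))$, the center of the centralizer of $A$. Super stable characters. An irreducible character $\chi$ of $G_r$ is super stable if $\chi|_{K^{l'}}$ contains some $\mathrm{Ind}_{J_M}^{K^{l'}}(\psi_{\hat M})$ with $\hat M$ a stable matrix of $\mathfrak{g}_l$ and $M=\hat M \bmod \pi^{l'}$. *)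

(* Defs.v *)
From HB Require Import structures.
From mathcomp Require Import all_boot all_order all_algebra.
From mathcomp Require Import all_fingroup all_solvable all_field all_character.

Set Implicit Arguments.
Unset Strict Implicit.
Unset Printing Implicit Defensive.

Import Order.TTheory GRing.Theory Num.Theory.
Local Open Scope ring_scope.

(* Non-Archimedean local fields, as fields that are complete for a normalized
   discrete valuation with finite residue field.  The value v 0 stands for
   +oo and is left unspecified: v is only ever read through [val_ge], or on
   nonzero elements. *)

Section Valuation.

Variables (F : fieldType) (v : F -> int).

Definition val_ge (n : int) (x : F) : bool := (x == 0) || (n <= v x).

Definition val_cauchy (u : nat -> F) : Prop :=
  forall n : int, exists m : nat,
    forall i j : nat, (m <= i)%N -> (m <= j)%N -> val_ge n (u i - u j).

Definition val_converges (u : nat -> F) (a : F) : Prop :=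
  forall n : int, exists m : nat,
    forall i : nat, (m <= i)%N -> val_ge n (u i - a).

Record local_valuation : Prop := LocalValuation {
  valM : forall x y, x != 0 -> y != 0 -> v (x * y) = v x + v y;
  valD : forall x y, x != 0 -> y != 0 -> x + y != 0 ->
           Num.min (v x) (v y) <= v (x + y);
  val_onto : exists2 x, x != 0 & v x = 1;
  val_complete : forall u, val_cauchy u -> exists a, val_converges u a;
  val_finite_residue : exists e : seq F,
    forall x, val_ge 0 x -> exists2 y, y \in e & val_ge 0 y && val_ge 1 (x - y)
}.

End Valuation.

Record localField := LocalField {
  lf_sort :> fieldType;
  lf_val : lf_sort -> int;
  lf_valP : local_valuation lf_val
}.

Section RingOfIntegers.

Variable F : localField.

Definition integral : {pred F} := fun x => val_ge (@lf_val F) 0 x.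

Lemma lf_val1 : lf_val (1 : F) = 0.
Proof.
have := valM (lf_valP F) (oner_neq0 _) (oner_neq0 _); rewrite mulr1.
by move/eqP; rewrite -subr_eq subrr eq_sym => /eqP.
Qed.

Lemma lf_valN (x : F) : x != 0 -> lf_val (- x) = lf_val x.
Proof.
move=> x0; have n10 : (-1 : F) != 0 by rewrite oppr_eq0 oner_neq0.
have vn1 : lf_val (-1 : F) = 0.
  have := valM (lf_valP F) n10 n10; rewrite mulrNN mulr1 lf_val1.
  by move/eqP; rewrite eq_sym -mulr2n mulrn_eq0 /= => /eqP.
by rewrite -mulN1r (valM (lf_valP F)) // vn1 add0r.
Qed.

Lemma integral_subring : subring_closed integral.
Proof.
split; rewrite /integral /in_mem /= /val_ge.
- by rewrite lf_val1 lexx orbT.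
- move=> x y; rewrite /in_mem /=.
  have [-> | x0] /= := eqVneq x 0; have [-> | y0] /= := eqVneq y 0.
  + by rewrite subrr eqxx.
  + by rewrite sub0r lf_valN // => _ ->; rewrite orbT.
  + by rewrite subr0 => -> _; rewrite orbT.
  move=> vx vy; have [//|xy0 /=] := eqVneq (x - y) 0.
  have y0' : - y != 0 by rewrite oppr_eq0.
  apply: le_trans (valD (lf_valP F) x0 y0' xy0).
  by rewrite le_min vx lf_valN.
- move=> x y; rewrite /in_mem /=.
  have [-> | x0] /= := eqVneq x 0; first by rewrite mul0r eqxx.
  have [-> | y0] /= := eqVneq y 0; first by rewrite mulr0 eqxx.
  by move=> vx vy; rewrite (valM (lf_valP F)) // addr_ge0 ?orbT.
Qed.

HB.instance Definition _ :=
  GRing.isSubringClosed.Build F integral integral_subring.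

Record integers := Integers {
  int_val :> F;
  int_valP : int_val \in integral
}.

HB.instance Definition _ := [isSub for int_val].
HB.instance Definition _ := [Choice of integers by <:].
HB.instance Definition _ := [SubChoice_isSubComNzRing of integers by <:].

(* a generator of the maximal ideal {x | v x >= 1} *)
Definition uniformizer (a : integers) : Prop :=
  forall x : integers,
    val_ge (@lf_val F) 1 (int_val x) <-> exists y, x = a * y.

End RingOfIntegers.

(* [quotients a] is a choice of rings realizing R / aR, when this is a finite
   field, and R / a^s R for s >= 1, when these are finite, each one given by a
   surjective morphism from R with the right kernel.  The index s = 0 is not
   constrained: MathComp rings are nontrivial, and R / a^0 R is zero.
   A finite commutative ring carries a unique unit-ring structure. *)

Record quotients (R : comNzRingType) (a : R) := Quotients {
  resfield : finFieldType;
  res : {rmorphism R -> resfield};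
  res_onto : forall y, exists x, res x == y;
  res_ker : forall x, res x = 0 <-> exists y, x = a * y;
  trunc : nat -> finComUnitRingType;
  red : forall s, {rmorphism R -> trunc s};
  red_onto : forall s y, exists x, red s x == y;
  red_ker : forall s, (0 < s)%N ->
    forall x, red s x = 0 <-> exists y, x = a ^+ s * y
}.

Section Reductions.

Variables (R : comNzRingType) (a : R) (Q : quotients a).

Definition lift s (y : trunc Q s) : R := xchoose (red_onto y).

(* The reductions R/a^s -> R/a^t (meaningful for 0 < t <= s) and
   R/a^s -> R/a (for 0 < s); the choice of the lift is then immaterial. *)
Definition trunc_red s t (y : trunc Q s) : trunc Q t := red Q t (lift y).
Definition res_red s (y : trunc Q s) : resfield Q := res Q (lift y).

Definition multiplicative_section (mu : resfield Q -> R) : Prop :=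
  (forall x y, mu (x * y) = mu x * mu y) /\ (forall x, res Q (mu x) = x).

End Reductions.

Section UnramifiedExtension.

Variable F : localField.

(* A normalized valuation on a finite extension restricts on F to e times that
   of F; the extension is unramified when e = 1, the residue extension being
   separable as the residue fields are finite. *)
Record unramified_extension := UnramifiedExtension {
  ue_field : fieldExtType F;
  ue_val : ue_field -> int;
  ue_valP : local_valuation ue_val;
  ue_unramified : forall x : F, x != 0 -> ue_val (x%:A) = lf_val x
}.

Definition ue_localField (E : unramified_extension) : localField :=
  LocalField (@ue_valP E).

Variable E : unramified_extension.

Lemma ue_embed_subproof (x : integers F) :
  ((int_val x)%:A : ue_field E) \in @integral (ue_localField E).
Proof.
case: x => x /=; rewrite /integral /in_mem /= /val_ge.
have [-> | x0] /= := eqVneq x 0; first by rewrite scale0r eqxx.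
by rewrite ue_unramified // => ->; rewrite orbT.
Qed.

Definition ue_embed (x : integers F) : integers (ue_localField E) :=
  @Integers (ue_localField E) _ (ue_embed_subproof x).

End UnramifiedExtension.

Section JordanForm.

Variable R : nzRingType.

Definition jordan_block n (lambda : R) : 'M[R]_n :=
  \matrix_(i, j) (lambda *+ (i == j) + (i.+1 == j :> nat)%:R).

Definition jordan_form n (A : 'M[R]_n) : Prop :=
  exists (m : nat) (d : 'I_m -> nat) (lambda : 'I_m -> R)
         (e : (\sum_i d i)%N = n),
    A = castmx (e, e) (\mxdiag_i jordan_block (d i) (lambda i)).

Definition in_center_of_centralizer n (A B : 'M[R]_n) : Prop :=
  comm_mx B A /\ (forall X : 'M[R]_n, comm_mx X A -> comm_mx B X).

End JordanForm.

(* All matrices below are N x N with N > 0; the size is written N.-1.+1 to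
   agree with the matrices underlying {'GL_N[R]}. *)

Section Stable.

Variables (F : localField) (pi : integers F) (Q : quotients pi).

Definition stable N s (M : 'M[trunc Q s]_N.-1.+1) : Prop :=
  exists (E : unramified_extension F) (Qh : quotients (ue_embed E pi))
         (mu : resfield Qh -> integers (ue_localField E)),
    multiplicative_section mu /\
    exists g A B : 'M[trunc Qh s]_N.-1.+1,
      [/\ g \in unitmx,
          g *m map_mx (fun x => red Qh s (ue_embed E (lift x))) M *m invmx g
            = A + red Qh s (ue_embed E pi) *: B,
          jordan_form A,
          A = map_mx (fun x => red Qh s (mu (res_red x))) A
        & in_center_of_centralizer A B].

End Stable.

(* I + c M_N(R), inside GL_N(R) *)
Section CongruenceSubgroup.

Variables (N : nat) (R : finComUnitRingType) (c : R).

Definition congruence_subgroup : {set {'GL_N[R]}} :=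
  [set g : {'GL_N[R]} |
    [exists X : 'M[R]_N.-1.+1, GLval g == 1%:M + c *: X]].

Lemma congruence_subgroup_group_set : group_set congruence_subgroup.
Proof.
apply/group_setP; split.
  by rewrite inE; apply/existsP; exists 0; rewrite scaler0 addr0 GL_1E.
move=> g h; rewrite !inE => /existsP[X /eqP gX] /existsP[Y /eqP hY].
apply/existsP; exists (X + Y + c *: (X *m Y)).
rewrite GL_MxE gX hY mulmxDl !mulmxDr !mulmx1 mul1mx -scalemxAl -scalemxAr.
by rewrite !scalerDr !addrA [_ + c *: Y + _]addrAC.
Qed.

Canonical congruence_subgroup_group := Group congruence_subgroup_group_set.

End CongruenceSubgroup.

(* Additive characters of F trivial on the ring of integers but not on
   pi^-1 times it.  Being trivial on the integers, such a character is smooth,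
   and its values are roots of unity since every element of F is p-power
   torsion modulo the integers: nothing is lost by taking values in algC. *)
Definition level_zero_character (F : localField) (pi : integers F)
    (psi : F -> algC) : Prop :=
  [/\ forall x y, psi (x + y) = psi x * psi y,
      forall x : integers F, psi (int_val x) = 1
    & exists x : integers F, psi ((int_val pi)^-1 * int_val x) != 1].

Section SuperStable.

Variables (F : localField) (pi : integers F) (Q : quotients pi).
Variables (psi : F -> algC) (N r : nat).

Local Notation O := (integers F).
Local Notation k := (resfield Q).
Local Notation Mat A := 'M[A]_N.-1.+1.

(* K^i = I + p^i M_N(O_r) *)
Definition congr_ker (i : nat) : {group {'GL_N[trunc Q r]}} :=
  [group of congruence_subgroup N (red Q r pi ^+ i)].

Definition commutator_form (Mbar X Y : Mat k) : k :=
  \tr (Mbar *m (X *m Y - Y *m X)).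

Definition isotropic (Mbar : Mat k) (V : {vspace Mat k}) : Prop :=
  forall X Y, X \in V -> Y \in V -> commutator_form Mbar X Y = 0.

Definition maximal_isotropic (Mbar : Mat k) (V : {vspace Mat k}) : Prop :=
  isotropic Mbar V /\
  forall W : {vspace Mat k}, isotropic Mbar W -> (V <= W)%VS -> W = V.

(* K^l <= J <= K^l' and J / K^l, seen in M_N(k) through
   I + pi^l' x |-> x mod pi, is a maximal isotropic subspace. *)
Definition is_J_M (l l' : nat) (M : Mat (trunc Q l'))
    (J : {group {'GL_N[trunc Q r]}}) : Prop :=
  [/\ congr_ker l \subset J, J \subset congr_ker l'
    & exists2 V : {vspace Mat k},
        maximal_isotropic (map_mx (@res_red _ _ Q l') M) V
      & forall (g : {'GL_N[trunc Q r]}) (x : Mat (trunc Q r)),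
          GLval g = 1%:M + red Q r pi ^+ l' *: x ->
          (g \in J) = (map_mx (@res_red _ _ Q r) x \in V)].

(* theta = psi_Mhat on J, the formula being evaluated in M_N(F) for all lifts
   Mt of Mhat and X of x to O; theta is zero off J as a class function. *)
Definition is_psi_hat (l l' : nat) (Mhat : Mat (trunc Q l))
    (J : {group {'GL_N[trunc Q r]}}) (theta : 'CF(J)) : Prop :=
  forall g, g \in J ->
  forall Mt X : Mat O,
    map_mx (red Q l) Mt = Mhat ->
    GLval g = 1%:M + red Q r pi ^+ l' *: map_mx (red Q r) X ->
    let MF := map_mx (@int_val F) Mt in
    let XF := map_mx (@int_val F) X in
    let piF := int_val pi in
    theta g =
      psi (piF ^- l * \tr (MF *m (XF - (2%:R^-1 * piF ^+ l') *: (XF *m XF)))).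

Definition super_stable (l l' : nat) (chi : 'CF('GL_N[trunc Q r])) : Prop :=
  exists Mhat : Mat (trunc Q l),
    stable Mhat /\
    let M : Mat (trunc Q l') := map_mx (@trunc_red _ _ Q l l') Mhat in
    exists (J : {group {'GL_N[trunc Q r]}}) (theta : 'CF(J)),
      [/\ is_J_M l M J, is_psi_hat l' Mhat theta
        & '['Res[congr_ker l'] chi, 'Ind[congr_ker l'] theta] != 0].

End SuperStable.

(* Main.v *)
Require Import Defs.
From mathcomp Require Import all_boot all_order all_algebra.
From mathcomp Require Import all_fingroup all_solvable all_field all_character.
From HB Require Import structures.
From mathcomp Require Import ring zify.

Set Implicit Arguments.
Unset Strict Implicit.
Unset Printing Implicit Defensive.

Import Order.TTheory GRing.Theory Num.Theory.
Local Open Scope ring_scope.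

(** Put e = pi^l'.  On the congruence subgroup K = 1 + e M_N the truncated logarithm
    log (1 + u) = u - u^2/2 turns the product into x + y + [x, y]/2, so K is a Heisenberg
    group for the pairing of x and y through tr (M [x, y]).  A constituent sigma of chi
    on K restricts to the radical R of that pairing as a multiple of
    Psi = psi (pi^-r tr (M log _)), vanishes off R, and its stabilizer is S K, where S
    is the group of matrices commuting with M modulo pi^l.

    The group S acts projectively on the space of sigma.  The parity operator, the sum of
    Psi(k)^-1 sigma(k) over K, commutes with S and is a multiple of an involution of
    trace 1; its eigenspaces have consecutive dimensions, so dividing an intertwiner by
    the ratio of its determinants on them makes the action linear, and trivial on R.
    Twisted by a linear character of S extending Psi, it glues with sigma to a
    representation of S K.

    That linear character is where stability enters.  After an unramified extension
    M = A + pi B with A in Jordan form and B central in the centralizer of A.  For X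
    commuting with M, off-diagonal entries of M do not contribute to tr (M X), so that
    Psi factors through the determinants of X on the generalized eigenspaces of A, and
    extends by extending characters of the unit group of the truncated ring. *)

(** * Normalising intertwiners by determinants *)

Section DetNormalisation.

(** Sylvester's identity: a unitriangular block matrix conjugates a triangular block matrix of
    determinant [\det (1 + A B)] into one of determinant [\det (1 + B A)]. *)
Lemma det_addmx1C (R : comPzRingType) m n (A : 'M[R]_(m, n)) (B : 'M[R]_(n, m)) :
  \det (1%:M + A *m B) = \det (1%:M + B *m A).
Proof.
have E : block_mx (1%:M + A *m B) (- A) 0 1%:M *m block_mx 1%:M 0 B 1%:M
       = block_mx 1%:M 0 B 1%:M *m block_mx 1%:M (- A) 0 (1%:M + B *m A).
  rewrite !mulmx_block !(mulmx1, mul1mx, mulmx0, mul0mx, addr0, add0r).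
  by rewrite mulNmx mulmxN addrK addrCA addNr addr0.
move/(congr1 determinant): E; rewrite !det_mulmx !det_ublock !det_lblock !det1.
by rewrite !(mulr1, mul1r).
Qed.

(** In the rank factorization [E = C R] idempotence forces [R C = 1], so trace and determinant can
    be computed in size [r], the rank of [E]. *)
Lemma det_addmx1_idem (F : fieldType) d (E : 'M[F]_d) : E *m E = E ->
  exists2 r : nat, \tr E = r%:R & forall a, \det (1%:M + a *: E) = (1 + a) ^+ r.
Proof.
move=> idE; have := col_base_full E; have := row_base_free E.
move: (col_base E) (row_base E) (mulmx_base E); move: (\rank E) => r C R defE.
move=> /row_freeP[B RB] /row_fullP[D DC].
have RC1 : R *m C = 1%:M.
  transitivity (D *m (E *m E) *m B).
    by rewrite -defE !mulmxA DC mul1mx -!mulmxA RB mulmx1.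
  by rewrite idE -defE !mulmxA DC mul1mx.
exists r; first by rewrite -defE mxtrace_mulC RC1 mxtrace1.
move=> a; rewrite -defE scalemxAl det_addmx1C -scalemxAr RC1.
by rewrite -[X in X + _]scale1r -scalerDl scalemx1 det_scalar.
Qed.

(** For complementary idempotents and [T] commuting with them, [T E + E'] is [T] on the image of [E]
    and the identity on that of [E']; its determinant is that of the restriction of [T]. *)
Lemma idem_pencilM (R : pzSemiRingType) d (E E' T T' : 'M[R]_d) :
    E *m E = E -> E' *m E' = E' -> E *m E' = 0 -> E' *m E = 0 ->
    E *m T' = T' *m E -> E' *m T' = T' *m E' ->
  (T *m E + E') *m (T' *m E + E') = T *m T' *m E + E'.
Proof.
move=> EE E'E' EE' E'E ET E'T; rewrite mulmxDl !mulmxDr.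
rewrite -(mulmxA T E (T' *m E)) (mulmxA E) ET -(mulmxA T') EE -(mulmxA T) EE'.
by rewrite (mulmxA E' T') E'T -(mulmxA T') E'E E'E' !mulmx0 addr0 add0r mulmxA.
Qed.

Variables (d : nat) (U : 'M[algC]_d).
Hypotheses (U2 : U *m U = 1%:M) (trU : \tr U = 1).

(** Projections onto the eigenspaces of [U] for 1 and -1. *)
Let Ep := 2%:R^-1 *: (1%:M + U).
Let Em := 2%:R^-1 *: (1%:M - U).

Let Epm : Ep + Em = 1%:M.
Proof.
rewrite -scalerDr addrACA subrr addr0 -mulr2n -scaler_nat scalerA.
by rewrite mulVf ?pnatr_eq0 // scale1r.
Qed.

Let idp : Ep *m Ep = Ep.
Proof.
rewrite -!(scalemxAl, scalemxAr) mulmxDl !mulmxDr !mulmx1 mul1mx U2.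
rewrite [U + _]addrC -mulr2n -scaler_nat [X in _ *: X]scalerA.
by rewrite mulVf ?scale1r ?pnatr_eq0.
Qed.

Let Emp : Em = 1%:M - Ep. Proof. by rewrite -Epm addrAC subrr add0r. Qed.

Let idm : Em *m Em = Em.
Proof.
by rewrite Emp mulmxBl !mulmxBr !mulmx1 mul1mx idp subrr subr0.
Qed.

Let pm0 : Ep *m Em = 0. Proof. by rewrite Emp mulmxBr mulmx1 idp subrr. Qed.
Let mp0 : Em *m Ep = 0. Proof. by rewrite Emp mulmxBl mul1mx idp subrr. Qed.

Let fp (T : 'M_d) := \det (T *m Ep + Em).
Let fm (T : 'M_d) := \det (T *m Em + Ep).

(* The two eigenspaces of U have dimensions differing by one, so the ratio of
   the determinants of T on them scales like T itself. *)
Definition det_ratio (T : 'M[algC]_d) : algC := fp T / fm T.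

Let comE T : T *m U = U *m T -> (Ep *m T = T *m Ep) * (Em *m T = T *m Em).
Proof.
move=> cT; rewrite /Ep /Em; split; rewrite -scalemxAl -scalemxAr; congr (_ *: _).
  by rewrite mulmxDl mulmxDr mulmx1 mul1mx cT.
by rewrite mulmxBl mulmxBr mulmx1 mul1mx cT.
Qed.

Lemma det_ratioM T T' : T *m U = U *m T -> T' *m U = U *m T' ->
  det_ratio (T *m T') = det_ratio T * det_ratio T'.
Proof.
move=> cT cT'; have [cp cm] := comE cT'.
by rewrite /det_ratio /fp /fm mulf_div -!det_mulmx !idem_pencilM.
Qed.

Lemma det_ratio_neq0 T : T *m U = U *m T -> T \in unitmx -> det_ratio T != 0.
Proof.
move=> cT uT; have cV : invmx T *m U = U *m invmx T.
  by rewrite -[LHS]mulmx1 -(mulmxV uT) !mulmxA -(mulmxA _ U) -cT mulmxA mulVmx // mul1mx.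
have := det_ratioM cT cV; rewrite mulmxV // => /esym E.
have : det_ratio 1%:M != 0.
  by rewrite /det_ratio /fp /fm !mul1mx [Em + _]addrC Epm det1 invr1 mulr1 oner_neq0.
by rewrite -E mulf_eq0 negb_or => /andP[].
Qed.

Lemma det_ratioZ a T : a != 0 -> T *m U = U *m T ->
  det_ratio (a *: T) = a * det_ratio T.
Proof.
move=> a0 cT; rewrite -[a *: T]mul_scalar_mx det_ratioM //; last by rewrite scalar_mxC.
congr (_ * _); rewrite /det_ratio /fp /fm !mul_scalar_mx.
have D E E' : E + E' = 1%:M -> a *: E + E' = 1%:M + (a - 1) *: E :> 'M[algC]_d.
  by move=> /(canRL (addKr _)) ->; rewrite scalerBl scale1r addrA addrC.
have [rp tp dp] := det_addmx1_idem idp; have [rm tm dm] := det_addmx1_idem idm.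
rewrite (D _ _ Epm) D ?[Em + _]addrC // dp dm addrC subrK.
(* The two ranks differ by the trace of [Ep - Em = U], which is 1. *)
suff -> : rp = rm.+1 by rewrite exprS mulfK // expf_neq0.
have : \tr (Ep - Em) = 1.
  rewrite -scalerBr opprB [_ + U]addrC addrACA subrr addr0 -mulr2n -scaler_nat scalerA.
  by rewrite mulVf ?pnatr_eq0 // scale1r.
rewrite linearB /= tp tm => /(canRL (subrK _)) E; apply/eqP.
by rewrite -(eqr_nat algC) E nat1r.
Qed.

End DetNormalisation.

(** The product [f s * g k] depends only on [s k] because [f] and [g] agree on the intersection, and
    the last hypothesis makes it multiplicative. With a ring as target, both matrix representations
    and linear characters can be glued. *)
Lemma glue_morphisms (gT : finGroupType) (A : pzRingType) (S K : {group gT})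
    (f g : gT -> A) :
  S \subset 'N(K)%g -> f 1%g = 1 ->
  {in S &, {morph f : x y / (x * y)%g >-> x * y}} ->
  {in K &, {morph g : x y / (x * y)%g >-> x * y}} ->
  {in S :&: K, f =1 g} ->
  {in S & K, forall s k, f s * g k = g (k ^ s^-1)%g * f s} ->
  exists h : gT -> A,
    [/\ {in (S <*> K)%g &, {morph h : x y / (x * y)%g >-> x * y}},
        {in S, h =1 f} & {in K, h =1 g}].
Proof.
move=> nKS f1 fM gM fg fgJ.
have g1 : g 1%g = 1 by rewrite -fg ?group1 ?f1 // inE !group1.
(* Any factorization may be picked, as [hE] shows; 0 is a default value off [S K]. *)
pose h x := if [pick s in S | (s^-1 * x)%g \in K] is Some s
            then f s * g (s^-1 * x)%g else 0.
have hE s k : s \in S -> k \in K -> h (s * k)%g = f s * g k.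
  move=> Ss Kk; rewrite /h; case: pickP => [t /andP[St Ktsk] | /(_ s)]; last first.
    by rewrite Ss mulKg Kk.
  have Kts : (t^-1 * s)%g \in K by rewrite mulgA groupMr in Ktsk.
  have Sts : (t^-1 * s)%g \in S by rewrite groupM ?groupV.
  by rewrite mulgA gM // -fg ?mulrA -?fM ?mulKVg // inE Sts Kts.
exists h; split=> [x y||].
- rewrite norm_joinEl // => /mulsgP[s k Ss Kk ->] /mulsgP[t m St Km ->].
  have -> : (s * k * (t * m) = (s * t) * (k ^ t * m))%g.
    by rewrite conjgE !mulgA mulgK.
  have Kkt : (k ^ t)%g \in K by rewrite memJ_norm // (subsetP nKS).
  rewrite (hE _ _ (groupM Ss St) (groupM Kkt Km)) !hE // fM // gM //.
  rewrite -!mulrA; congr (_ * _).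
  by rewrite !mulrA fgJ // conjgK.
- by move=> s Ss; rewrite -[s]mulg1 hE ?group1 // g1 mulr1 mulg1.
- by move=> k Kk; rewrite -[k]mul1g hE ?group1 // f1 mul1r mul1g.
Qed.

(** * Heisenberg representations and their extension by the stabilizer of the central character *)

Section Heisenberg.

Variables (gT : finGroupType) (S K R : {group gT}).
Variables (Psi : gT -> algC) (b : gT -> gT -> algC).
Hypotheses (nKS : S \subset 'N(K)%g) (SIK : S :&: K = R :> {set gT}).
Hypothesis Psi0 : {in K, forall k, Psi k != 0}.
Hypothesis PsiM : {in K &, forall g h, Psi (g * h)%g = Psi g * Psi h * b g h}.
Hypothesis bM : {in K & &, forall g h k, b (g * h)%g k = b g k * b h k}.
Hypothesis bC : {in K &, forall g h, b h g = (b g h)^-1}.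
Hypothesis bii : {in K, forall g, b g g = 1}.
Hypothesis b0 : {in K &, forall g h, b g h != 0}.
Hypothesis rad_b : {in R & K, forall z k, b z k = 1}.
(** The value of [Psi] at a commutator is the square of [b], so the radical is tested on squares. *)
Hypothesis rad_b2 :
  {in K, forall g, (forall k, k \in K -> b k g ^+ 2 = 1) -> g \in R}.
Hypothesis PsiJ : {in S & K, forall s k, Psi (k ^ s)%g = Psi k}.

Variables (d : nat) (rK : mx_representation algC K d).
Hypothesis irrK : mx_irreducible rK.

Let sRK : R \subset K. Proof. by rewrite -SIK subsetIr. Qed.
Let sRS : R \subset S. Proof. by rewrite -SIK subsetIl. Qed.
Let inK z : z \in R -> z \in K. Proof. exact: (subsetP sRK). Qed.

Let bMr : {in K & &, forall g h k, b k (g * h)%g = b k g * b k h}.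
Proof. by move=> g h k Kg Kh Kk; rewrite bC ?groupM // bM // invfM -!bC. Qed.

Let bV : {in K &, forall g h, b g^-1%g h = (b g h)^-1}.
Proof.
move=> g h Kg Kh; apply: (mulIf (b0 Kg Kh)).
by rewrite -bM ?groupV // mulVg mulVf ?b0 // rad_b.
Qed.

Let bVr : {in K &, forall g h, b h g^-1%g = (b h g)^-1}.
Proof. by move=> g h Kg Kh; rewrite bC ?groupV // bV // -bC. Qed.

Let Psi1 : Psi 1%g = 1.
Proof.
have /eqP := PsiM (group1 K) (group1 K); rewrite mulg1 rad_b // mulr1.
by rewrite -{1}[Psi 1%g]mulr1 eq_sym (inj_eq (mulfI (Psi0 (group1 K)))) => /eqP.
Qed.

Let PsiRM : {in R & K, forall z k, Psi (z * k)%g = Psi z * Psi k}.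
Proof. by move=> z k Rz Kk; rewrite PsiM ?(inK Rz) // rad_b // mulr1. Qed.

Let PsiMR : {in K & R, forall k z, Psi (k * z)%g = Psi k * Psi z}.
Proof. by move=> k z Kk Rz; rewrite PsiM ?(inK Rz) // bC ?(inK Rz) // rad_b // invr1 mulr1. Qed.

(** A bicharacter is trivial on commutators, which therefore lie in its radical. *)
Let comm_RK : {in K &, forall h g, [~ h, g]%g \in R}.
Proof.
move=> h g Kh Kg; apply: rad_b2 => [|k Kk]; first by rewrite groupR.
have := b0 Kk Kh; have := b0 Kk Kg.
rewrite commgEl conjgE !bMr ?groupM ?groupV // !bVr // => y0 x0.
by field; apply/andP.
Qed.

Let Psi_comm : {in K &, forall h g, Psi [~ h, g]%g = b h g ^+ 2}.
Proof.
move=> h g Kh Kg; have Rz := comm_RK Kh Kg.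
have := PsiM Kh Kg; rewrite commgC (PsiMR (groupM Kg Kh) Rz) PsiM //.
rewrite [b g h]bC // => E.
have nz : Psi g * Psi h / b h g != 0 by rewrite !mulf_neq0 ?invr_neq0 ?Psi0 ?b0.
apply: (mulfI nz); rewrite E; have b_hg := b0 Kh Kg; by field.
Qed.

(** Up to a factor, [Q] projects onto the vectors on which [R] acts through [Psi]. It commutes with
    [K], because conjugation moves [R] by commutators on which [Psi] is 1. By Schur's lemma it is
    invertible once it is nonzero. *)
Lemma intertwined_scalar (J : {group gT}) :
    R \subset J -> J \subset K ->
    \sum_(g in J) (Psi g)^-1 * \tr (rK g) != 0 ->
  {in R, forall z, rK z = (Psi z)%:M}.
Proof.
move=> sRJ sJK nz; pose Q := \sum_(z in R) (Psi z)^-1 *: rK z.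
have nRK : K \subset 'N(R)%g.
  apply/subsetP=> k Kk; rewrite inE; apply/subsetP=> _ /imsetP[z Rz ->].
  by rewrite conjg_mulR groupM // comm_RK // (inK Rz).
have Q0 : Q != 0.
  apply: contraNneq nz => Q0; suff : #|R|%:R * \sum_(g in J) (Psi g)^-1 * \tr (rK g) = 0.
    by move/eqP; rewrite mulf_eq0 pnatr_eq0 eqn0Ngt cardG_gt0.
  (* Translating by each [z] in [R] leaves the sum over [J] unchanged; averaging over [z] brings out
     [Q]. *)
  transitivity (\sum_(z in R) \sum_(g in J) (Psi (g * z)%g)^-1 * \tr (rK (g * z)%g)).
    rewrite mulr_natl -sumr_const; apply: eq_bigr => z Rz.
    rewrite (reindex_inj (mulIg z)) /=; apply: eq_bigl => g.
    by rewrite groupMr // (subsetP sRJ).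
  rewrite exchange_big /= big1 // => g Jg; have Kg := subsetP sJK _ Jg.
  transitivity ((Psi g)^-1 * \tr (rK g *m Q)); last by rewrite Q0 mulmx0 linear0 mulr0.
  rewrite mulmx_sumr raddf_sum mulr_sumr; apply: eq_bigr => z Rz /=.
  have Kz := inK Rz.
  by rewrite PsiMR // repr_mxM // -scalemxAr linearZ /= invfM mulrA.
have cQ : centgmx rK Q.
  apply/centgmxP => k Kk; rewrite mulmx_suml mulmx_sumr.
  rewrite [RHS](reindex_inj (conjg_inj k)) /=.
  apply: eq_big => [z|z Rz]; first by rewrite memJ_norm // (subsetP nRK).
  rewrite -scalemxAl -scalemxAr -!repr_mxM ?groupJ ?(inK Rz) // conjgC.
  congr (_^-1 *: _); have Kz := inK Rz.
  by rewrite conjg_mulR PsiMR ?comm_RK // Psi_comm // rad_b // expr1n mulr1.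
have uQ := mx_Schur irrK cQ Q0.
move=> z Rz; rewrite -[LHS]mulmx1 -(mulmxV uQ) mulmxA.
suff -> : rK z *m Q = Psi z *: Q by rewrite -scalemxAl mulmxV // scalemx1.
rewrite mulmx_sumr scaler_sumr [RHS](reindex_inj (mulgI z)) /=.
apply: eq_big => [w|w Rw]; first by rewrite groupMl.
have Kz := inK Rz; have Kw := inK Rw.
rewrite -scalemxAr -repr_mxM // PsiRM // scalerA invfM mulrA.
by rewrite divff ?mul1r // Psi0.
Qed.

Hypothesis rKR : {in R, forall z, rK z = (Psi z)%:M}.

(** Conjugation by [h] multiplies [rK g] by the scalar [b g h ^+ 2] and preserves its trace, so a
    nonzero trace forces all these scalars to be 1. *)
Lemma tr_off_radical g : g \in K -> g \notin R -> \tr (rK g) = 0.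
Proof.
move=> Kg; apply: contraNeq => trg; apply: rad_b2 => // h Kh.
have Rz := comm_RK Kg Kh; have Kz := inK Rz.
have : \tr (rK (g ^ h)%g) = \tr (rK g).
  by rewrite conjgE !repr_mxM ?groupM ?groupV // mxtrace_mulC repr_mxK.
rewrite conjg_mulR repr_mxM // (rKR Rz) mul_mx_scalar linearZ /=.
rewrite Psi_comm // -[RHS]mul1r => /(mulIf trg) b2.
by rewrite bC // exprVn b2 invr1.
Qed.

(** The character has norm 1 and is supported on [R], where each element contributes [d ^ 2]. *)
Lemma degree_radical : (d%:R ^+ 2 * #|R|%:R = #|K|%:R :> algC).
Proof.
have irr_rK : cfRepr rK \in irr K.
  by apply/irr_reprP; exists (Representation rK).
have := irrWnorm irr_rK; rewrite cfdotE => /(canRL (mulVKf _)).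
rewrite mulr1 => <-; last by rewrite pnatr_eq0 -lt0n cardG_gt0.
rewrite (big_setID R) /= (setIidPr sRK) [X in _ = _ + X]big1 => [|k /setDP[Kk nRk]]; last first.
  by rewrite cfunE Kk tr_off_radical // mul0r.
rewrite addr0 mulr_natr -sumr_const; apply: eq_bigr => z Rz; have Kz := inK Rz.
rewrite -char_inv ?cfRepr_char // !cfunE groupV Kz !rKR ?groupV // !mxtrace_scalar.
rewrite !mulr1n mulrnAl mulrnAr -PsiRM ?groupV // mulgV Psi1 -mulrnA.
by rewrite -natrX expnS expn1.
Qed.

Let d0 : d%:R != 0 :> algC.
Proof. by have [d_gt0 _] := (mx_irrP rK).1 irrK; rewrite pnatr_eq0 -lt0n. Qed.
Let cR0 : #|R|%:R != 0 :> algC.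
Proof. by rewrite pnatr_eq0 -lt0n cardG_gt0. Qed.

Lemma sum_pairing g : g \in K ->
  \sum_(k in K) b k g = if g \in R then #|K|%:R else 0.
Proof.
move=> Kg; case: ifPn => [Rg|].
  rewrite -sum1_card natr_sum; apply: eq_bigr => k Kk.
  by rewrite bC // rad_b ?invr1.
apply: contraNeq => nz; apply: rad_b2 => // h Kh.
suff -> : b h g = 1 by rewrite expr1n.
apply: (mulIf nz); rewrite mul1r mulr_sumr [RHS](reindex_inj (mulgI h)) /=.
by apply: eq_big => [k|k Kk]; rewrite ?groupMl // bM.
Qed.

(** Up to a scalar, the sum of the Weyl operators [(Psi k)^-1 *: rK k]: the operator by which -1
    acts in the Weil representation. The factor gives it trace 1. *)
Definition parity : 'M[algC]_d :=
  (d%:R * #|R|%:R)^-1 *: \sum_(k in K) (Psi k)^-1 *: rK k.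

Lemma parity_tr : \tr parity = 1.
Proof.
rewrite linearZ /= raddf_sum /= (big_setID R) /= (setIidPr sRK).
rewrite [X in _ + X]big1 => [|k /setDP[Kk nRk]]; last first.
  by rewrite linearZ /= tr_off_radical // mulr0.
rewrite (eq_bigr (fun=> d%:R)) => [|z Rz].
  by rewrite addr0 sumr_const -[X in _ * X]mulr_natr mulVf ?mulf_neq0.
by rewrite linearZ /= rKR // mxtrace_scalar mulrnAr mulVf // Psi0 ?(inK Rz).
Qed.

(** Weyl operators multiply up to the factor [b], so the coefficient at [g] is a character sum over
    [K], which vanishes off [R]. The degree formula evaluates what remains. *)
Lemma parity_sqr : parity *m parity = 1%:M.
Proof.
rewrite -scalemxAl -scalemxAr scalerA.
have -> : (\sum_(k in K) (Psi k)^-1 *: rK k) *m (\sum_(k in K) (Psi k)^-1 *: rK k)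
   = \sum_(g in K) (\sum_(k in K) b k g) *: ((Psi g)^-1 *: rK g).
  rewrite mulmx_suml.
  under [RHS]eq_bigr => g _ do rewrite scaler_suml.
  rewrite [RHS]exchange_big /=; apply: eq_bigr => k Kk.
  rewrite mulmx_sumr (reindex_inj (mulgI k^-1%g)) /=.
  apply: eq_big => [g|g Kg]; first by rewrite groupMl ?groupV.
  rewrite groupMl ?groupV // in Kg.
  have Kkg : (k^-1 * g)%g \in K by rewrite groupM ?groupV.
  rewrite -scalemxAl -scalemxAr -repr_mxM // mulKVg !scalerA; congr (_ *: _).
  have := PsiM Kk Kkg; rewrite mulKVg bMr ?groupV // bVr // bii // invr1 mul1r => ->.
  have := b0 Kk Kg; have := Psi0 Kk; have := Psi0 Kkg => *; field.
  by apply/and3P.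
rewrite (big_setID R) /= (setIidPr sRK) [X in _ + X]big1 => [|k /setDP[Kk nRk]]; last first.
  by rewrite sum_pairing // (negPf nRk) scale0r.
rewrite addr0 (eq_bigr (fun=> #|K|%:R%:M)) => [|z Rz]; last first.
  have Kz := inK Rz.
  by rewrite sum_pairing // Rz rKR // scale_scalar_mx mulVf ?Psi0 // scalemx1.
rewrite sumr_const -scaler_nat scale_scalar_mx scale_scalar_mx -degree_radical.
by congr _%:M; field; apply/andP.
Qed.

Let intertwines s (T : 'M[algC]_d) :=
  [&& T \in unitmx, [forall k in K, T *m rK k == rK (k ^ s^-1)%g *m T]
    & T *m parity == parity *m T].

(** The representation and its twist by [s] have the same character: both traces vanish off [R] and
    are [d] times [Psi] on it. An isomorphism commutes with [parity] because [s] permutes the terms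
    of that sum. The implication lets a choice be made over the whole finite group. *)
Let intertwiner_ex s : exists T, (s \in S) ==> intertwines s T.
Proof.
have [Ss|] := boolP (s \in S); last by exists 0.
have KJ k : (k ^ s^-1 \in K)%g = (k \in K).
  by rewrite memJ_norm // groupV (subsetP nKS).
have PJ k : k \in K -> Psi (k ^ s^-1)%g = Psi k.
  by move=> Kk; rewrite -[in RHS](conjgKV s k) [RHS](PsiJ Ss) ?KJ.
have rJ : mx_repr K (fun k => rK (k ^ s^-1)%g).
  by split=> [|k h Kk Kh]; rewrite ?conj1g ?repr_mx1 // conjMg repr_mxM ?KJ.
have /cfRepr_rsimP[B e freeB BJ] : cfRepr rK == cfRepr (MxRepresentation rJ).
  apply/eqP/cfun_inP=> k Kk; rewrite !cfunE Kk /=.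
  have RJ : (k ^ s^-1 \in R)%g = (k \in R).
    by rewrite -SIK !inE KJ memJ_norm // groupV (subsetP (normG S)).
  have [Rk|nRk] := boolP (k \in R); last by rewrite !tr_off_radical ?KJ ?RJ.
  by rewrite !rKR ?RJ // PJ.
have uB : invmx B \in unitmx by rewrite unitmx_inv -row_free_unit.
have {}BJ k : k \in K -> invmx B *m rK k = rK (k ^ s^-1)%g *m invmx B.
  move=> Kk; have /(congr1 (fun X => invmx B *m X *m invmx B)) := BJ k Kk.
  rewrite unitmx_inv in uB.
  by rewrite /= !mulmxA mulmxK // mulVmx // mul1mx.
exists (invmx B); apply/and3P; split=> //; first by apply/forall_inP=> k /BJ->.
rewrite -scalemxAl -scalemxAr mulmx_sumr mulmx_suml; apply/eqP; congr (_ *: _).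
rewrite [RHS](reindex_inj (conjg_inj s^-1%g)) /=.
apply: eq_big => [k|k Kk]; first by rewrite KJ.
by rewrite -scalemxAl -scalemxAr BJ // PJ.
Qed.

(** By Schur's lemma the intertwiners multiply up to scalars. [det_ratio parity] is multiplicative
    and scales like its argument, so dividing by it removes these scalars. *)
Lemma symplectic_action : exists W : gT -> 'M[algC]_d,
  [/\ {in S &, {morph W : x y / (x * y)%g >-> x *m y}},
      {in S & K, forall s k, W s *m rK k = rK (k ^ s^-1)%g *m W s}
    & {in R, forall z, W z = 1%:M}].
Proof.
have [T TP] : exists T : gT -> 'M[algC]_d, forall s, s \in S -> [/\ T s \in unitmx,
    forall k, k \in K -> T s *m rK k = rK (k ^ s^-1)%g *m T s
    & T s *m parity = parity *m T s].
  have /fin_all_exists[T TP] := intertwiner_ex; exists T => s Ss.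
  have /implyP/(_ Ss)/and3P[uT /forall_inP TJ /eqP TP'] := TP s.
  by split=> // k /TJ/eqP.
have scal A : centgmx rK A -> exists a, A = a%:M.
  move=> cA; apply/is_scalar_mxP; apply: mx_abs_irr_cent_scalar cA.
  exact: groupC.
have Tsc s (A : 'M_d) : s \in S -> A \in unitmx ->
    (forall k, k \in K -> A *m rK k = rK (k ^ s^-1)%g *m A) ->
    exists2 a, a != 0 & A = a *: T s.
  move=> Ss uA AJ; have [uT TJ _] := TP s Ss.
  have [|a Ea] := scal (invmx (T s) *m A).
    apply/centgmxP=> k Kk; rewrite -mulmxA AJ // !mulmxA; congr (_ *m _).
    by apply: (canRL (mulmxK uT)); rewrite -mulmxA -TJ // mulKmx.
  have EA : A = a *: T s by rewrite -mul_mx_scalar -Ea mulKVmx.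
  exists a => //; apply: contraTneq uA => a0; rewrite EA a0 scale0r.
  rewrite -row_free_unit /row_free mxrank0 eq_sym -lt0n.
  by have [] := (mx_irrP rK).1 irrK.
pose W s := (det_ratio parity (T s))^-1 *: T s.
exists W; split=> [s t Ss St|s k Ss Kk|z Rz].
- have [us sJ sP] := TP s Ss; have [ut tJ tP] := TP t St.
  have [ust _ stP] := TP _ (groupM Ss St).
  have [|k Kk|a a0 Ea] := Tsc _ (T s *m T t) (groupM Ss St).
  + by rewrite unitmx_mul us.
  + rewrite -mulmxA tJ // mulmxA sJ ?memJ_norm ?groupV ?(subsetP nKS) //.
    by rewrite -mulmxA -conjgM -invMg.
  rewrite /W -scalemxAl -scalemxAr scalerA -invfM -(det_ratioM parity_sqr sP tP).
  rewrite Ea det_ratioZ ?parity_sqr ?parity_tr //. have Dst := det_ratio_neq0 parity_sqr stP ust.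
  by rewrite scalerA; congr (_ *: _); field; rewrite Dst.
- have [us sJ sP] := TP s Ss.
  by rewrite /W -scalemxAl -scalemxAr sJ.
- have Sz := subsetP sRS z Rz; have [uz zJ zP] := TP z Sz.
  (* Since [rK z] is scalar, the identity intertwines as well, and [T z] is a scalar matrix. *)
  have [|k Kk|a a0 Ea] := Tsc z 1%:M Sz; first by rewrite unitmx1.
  + have Kz := inK Rz; have RzV : z^-1%g \in R by rewrite groupV.
    rewrite mul1mx mulmx1 conjgE invgK mulgA !repr_mxM ?groupM ?groupV //.
    rewrite (rKR Rz) (rKR RzV) mul_scalar_mx mul_mx_scalar scalerA -PsiRM ?groupV //.
    by rewrite mulVg Psi1 scale1r.
  have E1 : det_ratio parity 1%:M = 1.
    have D := det_ratioM parity_sqr (comm1mx parity) (comm1mx parity).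
    have nz := det_ratio_neq0 parity_sqr (comm1mx parity) (unitmx1 _ _).
    by apply: (mulIf nz); rewrite mul1r -D mulmx1.
  have TzE : T z = a^-1 *: 1%:M by rewrite Ea scalerA mulVf // scale1r.
  rewrite /W TzE det_ratioZ ?invr_eq0 ?parity_sqr ?parity_tr ?E1 ?mulr1 //.
    by rewrite invrK scalerA divff // scale1r.
  by rewrite mul1mx mulmx1.
Qed.

Variable om : gT -> algC.
Hypothesis omM : {in S &, {morph om : x y / (x * y)%g >-> x * y}}.
Hypothesis omR : {in R, om =1 Psi}.

(** As [W] is trivial on [R], its twist by [om] is there the scalar [Psi], like [rK]; the two
    actions glue. *)
Theorem heisenberg_extension : exists rG : mx_representation algC (S <*> K) d,
  {in K, forall k, rG k = rK k}.
Proof.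
have [W [WM WJ WR]] := symplectic_action.
have [|||||h [hM hS hK]] := glue_morphisms (A := 'M[algC]_d)
    (f := fun s => om s *: W s) (g := rK) nKS.
- by rewrite omR // WR // Psi1 scale1r.
- by move=> s t Ss St; rewrite -mulmxE omM // WM // -scalemxAl -scalemxAr scalerA.
- exact: repr_mxM.
- by move=> z; rewrite SIK => Rz; rewrite omR // WR // rKR // scalemx1.
- by move=> s k Ss Kk; rewrite -!mulmxE -scalemxAl -scalemxAr WJ.
have rh : mx_repr (S <*> K)%g h by split=> //; rewrite hK // repr_mx1.
by exists (MxRepresentation rh) => k Kk; rewrite /= hK.
Qed.

End Heisenberg.

(** * Clifford and Gallagher correspondences *)

Section CliffordGallagher.

Variables (gT : finGroupType) (G K : {group gT}).
Hypothesis nsKG : (K <| G)%g.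

Lemma extension_conj (s : 'CF(K)) (y : gT) : y \in G ->
  (exists2 st : 'CF('I_G[s]), st \is a character & 'Res[K] st = s) ->
  exists2 st : 'CF('I_G[(s ^ y)%CF]), st \is a character & 'Res[K] st = (s ^ y)%CF.
Proof.
move=> Gy [st /char_reprP[[d rT] ->] /= resT].
have nKy : y \in 'N(K)%g by rewrite (subsetP (normal_norm nsKG)).
have IE x : (x \in 'I_G[(s ^ y)%CF])%g = (x ^ y^-1 \in 'I_G[s])%g.
  by rewrite -mem_conjg conjIg conjg_inertia // conjGid.
have rTy : mx_repr 'I_G[(s ^ y)%CF] (fun x => rT (x ^ y^-1)%g).
  split=> [|x z Ix Iz]; first by rewrite conj1g repr_mx1.
  by rewrite conjMg repr_mxM -?IE.
exists (cfRepr (MxRepresentation rTy)); first exact: cfRepr_char.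
apply/cfun_inP=> x Kx; rewrite cfConjgE //.
have KI (u : 'CF(K)) : K \subset 'I_G[u]%g by rewrite sub_Inertia ?normal_sub.
have Kxy : (x ^ y^-1)%g \in K by rewrite memJ_norm ?groupV.
have := congr1 (fun f : 'CF(K) => f (x ^ y^-1)%g) resT; rewrite /= => <-.
by rewrite !cfResE // !cfunE /= IE (subsetP (KI _) _ Kxy).
Qed.

(** It is enough to extend one constituent [s0]: conjugation carries the extension to [sigma].
    Clifford's correspondence then induces [chi] from the inertia group, and Gallagher's factors the
    inducing character through the extension. *)
Lemma irr_Ind_extension (chi : 'CF(G)) (s0 sigma : 'CF(K)) :
    chi \in irr G -> s0 \in irr K -> sigma \in irr K ->
    '['Res[K] chi, s0] != 0 -> '['Res[K] chi, sigma] != 0 ->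
    (exists2 st : 'CF('I_G[s0]), st \is a character & 'Res[K] st = s0) ->
  exists sigmat : 'CF('I_G[sigma]),
    [/\ sigmat \is a character, 'Res[K] sigmat = sigma
      & exists2 rho : 'CF('I_G[sigma] / K), rho \in irr ('I_G[sigma] / K)
        & chi = 'Ind[G] (sigmat * (rho %% K)%CF)].
Proof.
move=> /irrP[c ->] /irrP[i ->] /irrP[t ->] ci ct ext.
have Ei := Clifford_Res_sum_cfclass nsKG ci.
(* The restriction of [chi] is a multiple of the sum of the conjugates of [s0], so [sigma] is one of
   them. *)
have /cfclassP[y Gy Et] : 'chi_t \in ('chi_i ^: G)%CF.
  apply: contraNT ct => nt; rewrite Ei cfdotZl reindex_cfclass //.
  rewrite cfdot_suml big1 ?mulr0 // => j cj; rewrite cfdot_irr.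
  by case: eqP => // ji; rewrite ji in cj; rewrite cj in nt.
have := extension_conj Gy ext; rewrite -Et => -[st chst rest].
exists st; split=> //.
have nsKT : (K <| 'I_G['chi_t])%g by rewrite normal_Inertia ?normal_sub.
have irr_st : st \in irr 'I_G['chi_t]%g.
  by apply: (@cfRes_irr_irr _ _ K _ chst); rewrite rest mem_irr.
have [/= A _ B _ _] := constt_Inertia_bijection t nsKG.
have : c \in irr_constt ('Ind[G] 'chi_t) by rewrite constt_Ind_Res.
rewrite -B => /imsetP[k kA ck].
have Ec : 'chi_c = 'Ind[G] 'chi_k by rewrite ck cfIirrE ?A.
have /irrP[j Ej] := irr_st; rewrite Ej in rest *.
have [Ci _ Cs _] := constt_Ind_ext nsKT rest.
move: kA; rewrite Cs => /codomP[b kb].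
exists 'chi_b; first exact: mem_irr.
by rewrite Ec kb cfIirrE ?Ci // mod_IirrE ?normal_sub // mulrC.
Qed.

End CliffordGallagher.

(** * Truncated logarithm and finite duality *)

Section TruncatedLog.

Variables (R : comPzRingType) (n : nat) (half : R).
Hypothesis half2 : half + half = 1.
Implicit Types u v w : 'M[R]_n.

Definition tlog u : 'M[R]_n := u - half *: (u *m u).

(** The Baker-Campbell-Hausdorff formula, which stops at the first commutator when triple products
    vanish. *)
Lemma tlogM u v :
    (forall x y z, x \in [:: u; v] -> y \in [:: u; v] -> z \in [:: u; v] ->
       x *m y *m z = 0) ->
  tlog (u + v + u *m v) =
    tlog u + tlog v + half *: (tlog u *m tlog v - tlog v *m tlog u).
Proof.
move=> uv3; have [mu mv] : u \in [:: u; v] /\ v \in [:: u; v].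
  by rewrite !inE !eqxx orbT.
have z3 x y z : x \in [:: u; v] -> y \in [:: u; v] -> z \in [:: u; v] ->
    x *m (y *m z) = 0 by move=> *; rewrite mulmxA uv3.
have lM x y : x \in [:: u; v] -> y \in [:: u; v] -> tlog x *m tlog y = x *m y.
  move=> mx my; rewrite /tlog mulmxBl !mulmxBr -!(scalemxAl, scalemxAr).
  by rewrite !mulmxA !uv3 // mul0mx !scaler0 !subr0.
rewrite !lM // /tlog !(mulmxDl, mulmxDr) !mulmxA !uv3 // mul0mx !addr0.
rewrite -{1}[u *m v]scale1r -half2.
move: (u *m u) (u *m v) (v *m u) (v *m v) => P Q T S.
by apply/matrixP=> i j; rewrite !mxE; ring.
Qed.

Lemma tlog_exp u : u *m u *m u = 0 -> tlog (u + half *: (u *m u)) = u.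
Proof.
move=> u3; rewrite /tlog mulmxDl !mulmxDr -!(scalemxAl, scalemxAr) !mulmxA u3.
by rewrite mul0mx !scaler0 !addr0 addrK.
Qed.

Lemma tlogJ s t u : t *m s = 1%:M -> tlog (s *m u *m t) = s *m tlog u *m t.
Proof.
move=> ts; rewrite /tlog mulmxBr mulmxBl -scalemxAr -scalemxAl; congr (_ - _ *: _).
by rewrite !mulmxA -(mulmxA _ t s) ts mulmx1.
Qed.

End TruncatedLog.

Section FiniteDuality.

Variables (V : finZmodType) (phi : V -> V -> algC).
Hypothesis (phiDl : forall x y z, phi (x + y) z = phi x z * phi y z).
Hypothesis phi0 : forall x, phi 0 x = 1.
Hypotheses (phi_sym : forall x y, phi x y = phi y x)
           (phi_nd : forall x, (forall y, phi x y = 1) -> x = 0).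

Definition perp (A : {set V}) : {set V} := [set x | [forall a in A, phi a x == 1]].

Lemma sum_orth (A : {set V}) x :
    0 \in A -> (forall a b, a \in A -> b \in A -> b - a \in A) ->
  \sum_(a in A) phi a x = if x \in perp A then #|A|%:R else 0.
Proof.
move=> A0 AB; rewrite inE; case: ifPn => [/forall_inP xA | ].
  by rewrite -sum1_card natr_sum; apply: eq_bigr => a /xA/eqP.
rewrite negb_forall_in => /exists_inP[b Ab phib]; apply/eqP.
have AD a c : a \in A -> c \in A -> a + c \in A.
  by move=> Aa Ac; rewrite -[a]opprK addrC AB // -sub0r AB.
have : phi b x * \sum_(a in A) phi a x = \sum_(a in A) phi a x.
  rewrite mulr_sumr [RHS](reindex_inj (addrI b)) /=.
  apply: eq_big => [a | a Aa]; last by rewrite phiDl.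
  apply/idP/idP => [Aa|Aa]; first exact: AD.
  by rewrite -[a](addKr b) addrC AB.
by move/eqP; rewrite -subr_eq0 -{2}[\sum_(a in A) _]mul1r -mulrBl mulf_eq0 subr_eq0 (negPf phib).
Qed.

(** Sum [phi a x] over all [a] in [A] and [x] in [V] in both orders: orthogonality leaves only
    [a = 0] in one and only [x] in [perp A] in the other. *)
Lemma card_perp (A : {set V}) :
    0 \in A -> (forall a b, a \in A -> b \in A -> b - a \in A) ->
  (#|A| * #|perp A| = #|V|)%N.
Proof.
move=> A0 AB; apply/eqP; rewrite -(eqr_nat algC) natrM.
have -> : #|V|%:R = \sum_(a in A) \sum_x phi a x :> algC.
  rewrite (bigD1 0) //= [X in _ + X]big1 => [|a /andP[_ a0]].
    rewrite addr0 (eq_bigr (fun=> 1)) => [|x _]; last exact: phi0.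
    by rewrite sumr_const.
  rewrite (eq_bigl (fun x => x \in [set: V])) => [|x]; last by rewrite inE.
  rewrite (eq_bigr (fun x => phi x a)) => [|x _]; last exact: phi_sym.
  rewrite sum_orth ?inE // => [|x y _ _]; last by rewrite inE.
  case: ifP => // /forall_inP aP; case/eqP: a0; apply: phi_nd => y.
  by rewrite phi_sym; apply/eqP/aP; rewrite inE.
rewrite exchange_big /= (bigID (mem (perp A))) /= [X in _ == _ + X]big1 => [|x /negPf nx].
  rewrite addr0 (eq_bigr (fun=> #|A|%:R)) => [|x px]; last by rewrite sum_orth // px.
  by rewrite sumr_const mulr_natr.
by rewrite sum_orth // nx.
Qed.

(** The inclusion of [A] in its double orthogonal is formal, and counting shows equal
    cardinalities. *)
Lemma perpK (A : {set V}) :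
    0 \in A -> (forall a b, a \in A -> b \in A -> b - a \in A) ->
  perp (perp A) = A.
Proof.
move=> A0 AB; have phiV x y : phi x y != 0.
  apply/eqP=> xy; have /eqP := phi0 y; rewrite -(subrr x) phiDl xy mul0r.
  by rewrite eq_sym oner_eq0.
have phiB a b x : phi a x = 1 -> phi b x = 1 -> phi (b - a) x = 1.
  by move=> ax bx; apply: (mulIf (phiV a x)); rewrite -phiDl subrK bx ax mulr1.
have P0 : 0 \in perp A by rewrite inE; apply/forall_inP=> a _; rewrite phi_sym phi0.
have PB a b : a \in perp A -> b \in perp A -> b - a \in perp A.
  rewrite !inE => /forall_inP pa /forall_inP pb; apply/forall_inP=> x Ax.
  by rewrite phi_sym; apply/eqP/phiB; rewrite phi_sym; apply/eqP; [apply: pa | apply: pb].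
have sAP : A \subset perp (perp A).
  apply/subsetP=> a Aa; rewrite inE; apply/forall_inP=> x; rewrite inE => /forall_inP px.
  by rewrite phi_sym px.
apply/esym/eqP; rewrite eqEcard sAP /= -(leq_pmul2l (m := #|perp A|)) ?card_perp //.
  by rewrite mulnC card_perp.
by apply/card_gt0P; exists 0.
Qed.

End FiniteDuality.

(** * Congruence subgroups and centralizers modulo an annihilator *)

Lemma unitmx_add1_nil (R : comUnitRingType) n (u : 'M[R]_n) :
  u *m u *m u = 0 -> 1%:M + u \in unitmx.
Proof.
move=> u3; suff : (1%:M + u) *m (1%:M - u + u *m u) = 1%:M.
  by case/mulmx1_unit.
rewrite mulmxDl mul1mx !mulmxDr mulmx1 mulmxN mulmxA u3 addr0.
by move: (u *m u) => P; apply/matrixP=> i j; rewrite !mxE; ring.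
Qed.

Lemma GL_of_unitmx (R : finComUnitRingType) N (A : 'M[R]_N.-1.+1) :
  A \in unitmx -> exists g : {'GL_N[R]}, GLval g = A.
Proof. by move=> uA; exists (Sub A uA); rewrite -[LHS]/(val _) SubK. Qed.

Lemma GL_J (R : finComUnitRingType) N (s g : {'GL_N[R]}) :
  GLval (g ^ s)%g = invmx s *m g *m s.
Proof. by rewrite conjgE GL_MxE GL_MxE GL_VxE mulmxA. Qed.

Lemma GL_mulVmx (R : finComUnitRingType) N (s : {'GL_N[R]}) : invmx s *m s = 1%:M.
Proof. exact/mulVmx/GL_unitmx. Qed.

Lemma GL_mulmxV (R : finComUnitRingType) N (s : {'GL_N[R]}) : s *m invmx s = 1%:M.
Proof. exact/mulmxV/GL_unitmx. Qed.

Lemma congr_subP (R : finComUnitRingType) N (e : R) (g : {'GL_N[R]}) :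
  reflect (exists x, GLval g = 1%:M + e *: x) (g \in congruence_subgroup N e).
Proof. by rewrite inE; apply: (iffP existsP) => -[x /eqP]; exists x => //; apply/eqP. Qed.

Lemma congruence_norm (R : finComUnitRingType) N (e : R) (G : {set {'GL_N[R]}}) :
  G \subset 'N(congruence_subgroup N e)%g.
Proof.
apply/subsetP=> s _; rewrite inE; apply/subsetP=> _ /imsetP[g /congr_subP[x gx] ->].
apply/congr_subP; exists (invmx (GLval s) *m x *m GLval s).
by rewrite GL_J gx mulmxDr mulmxDl mulmx1 GL_mulVmx -scalemxAr -scalemxAl.
Qed.

Section CentralizerModulo.

Variables (N : nat) (R : finComUnitRingType) (e : R) (M : 'M[R]_N.-1.+1).

(** Multiplying by [e] tests commutation modulo the annihilator of [e]; for [e = pi^l'] in [O_r]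
    with [r = l + l'] this is commutation modulo [pi^l]. *)
Definition mod_cent : {set {'GL_N[R]}} :=
  [set g : {'GL_N[R]} | e *: (M *m g) == e *: (g *m M)].

Lemma mod_cent_group_set : group_set mod_cent.
Proof.
apply/group_setP; split=> [|g h].
  by rewrite inE GL_1E mulmx1 mul1mx.
rewrite !inE GL_MxE => /eqP gM /eqP hM.
by rewrite mulmxA scalemxAl gM -scalemxAl -mulmxA scalemxAr hM -scalemxAr mulmxA.
Qed.

Canonical mod_cent_group := Group mod_cent_group_set.

End CentralizerModulo.

(** * The Heisenberg structure of a congruence subgroup *)

Section MatrixHeisenberg.

Variables (N : nat) (R : finComUnitRingType) (e half : R) (phi : R -> algC).
Variable M : 'M[R]_N.-1.+1.
Hypotheses (e3 : e ^+ 3 = 0) (half2 : half + half = 1).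
Hypothesis phi0 : phi 0 = 1.
Hypothesis phiD : forall x y, phi (x + y) = phi x * phi y.
Hypothesis phi_prim : forall y, (forall z, phi (y * z) = 1) -> y = 0.

Local Notation Mat := 'M[R]_N.-1.+1.
Local Notation gT := {'GL_N[R]}.
Let K := [group of congruence_subgroup N e].
Let S := [group of mod_cent e M].
Let RM := (S :&: K)%G.

Definition glog (g : gT) : Mat := tlog half (GLval g - 1%:M).
Definition glog_char (g : gT) : algC := phi (\tr (M *m glog g)).
Definition glog_pairing (g h : gT) : algC :=
  phi (half * \tr (M *m (glog g *m glog h - glog h *m glog g))).

Local Notation Psi := glog_char.
Local Notation b := glog_pairing.

Let phi_n0 x : phi x != 0.
Proof.
by apply/eqP=> x0; have /eqP := phi0; rewrite -(subrr x) phiD x0 mul0r eq_sym oner_eq0.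
Qed.

Let phiN x : phi (- x) = (phi x)^-1.
Proof. by apply: (mulfI (phi_n0 x)); rewrite -phiD subrr phi0 divff. Qed.

Let sc3 (x y z : Mat) : (e *: x) *m (e *: y) *m (e *: z) = 0.
Proof.
by rewrite -!(scalemxAl, scalemxAr) !scalerA -[e * (e * e)]/(e ^+ 3) e3 scale0r.
Qed.

(** Testing against [z] times an elementary matrix isolates one entry of [A], multiplied by [z]. *)
Lemma phi_trace_nd (A : Mat) : (forall B : Mat, phi (\tr (A *m B)) = 1) -> A = 0.
Proof.
move=> A1; apply/matrixP=> i j; rewrite mxE; apply: phi_prim => z.
rewrite -[RHS](A1 (z *: delta_mx j i)) -scalemxAr linearZ /= mulrC; congr (phi (_ * _)).
rewrite -(mul_delta_mx (0 : 'I_1)) mulmxA mxtrace_mulC mulmxA -rowE -colE.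
by rewrite /mxtrace big_ord1 !mxE.
Qed.

Let tlog_e (x : Mat) : tlog half (e *: x) = e *: (x - (half * e) *: (x *m x)).
Proof.
rewrite /tlog -scalemxAl -scalemxAr scalerBr !scalerA; congr (_ - _ *: _); ring.
Qed.

Let glogE (g : gT) : g \in K -> exists x, glog g = e *: x.
Proof.
by case/congr_subP=> x gx; rewrite /glog gx addrAC subrr add0r tlog_e; eexists.
Qed.

Lemma glogM (g h : gT) : g \in K -> h \in K ->
  glog (g * h)%g = glog g + glog h + half *: (glog g *m glog h - glog h *m glog g).
Proof.
case/congr_subP=> x gx /congr_subP[y hy]; rewrite /glog GL_MxE gx hy.
rewrite ![_ + _ - 1%:M]addrAC subrr !add0r -(tlogM half2).
  congr (tlog _ _); rewrite mulmxDl !mulmxDr !mulmx1 mul1mx.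
  by rewrite -[1%:M + _ + _]addrA [1%:M + _]addrC addrK [_ + (e *: x + _)]addrCA addrA.
by move=> a c d; rewrite !inE => /pred2P[]-> /pred2P[]-> /pred2P[]->; apply: sc3.
Qed.

Let congr_unit (x : Mat) : exists g : gT, GLval g = 1%:M + e *: x.
Proof. by apply: GL_of_unitmx; apply/unitmx_add1_nil/sc3. Qed.

Lemma glog_onto (x : Mat) : exists2 g : gT, g \in K & glog g = e *: x.
Proof.
pose u := e *: x; have u3 : u *m u *m u = 0 by apply: sc3.
have [|g gE] := @GL_of_unitmx R N (1%:M + (u + half *: (u *m u))).
  move: u u3 => u u3 {x}.
  (* The candidate is the truncated exponential of [u]; its inverse is that of [- u]. *)
  suff : (1%:M + (u + half *: (u *m u))) *m (1%:M - u + half *: (u *m u)) = 1%:M.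
    by case/mulmx1_unit.
  transitivity (1%:M + (half + half - 1) *: (u *m u)); last first.
    by rewrite half2 subrr scale0r addr0.
  rewrite !(mulmxDl, mulmxDr) !(mulmxN, mulNmx) -!(scalemxAl, scalemxAr) !mulmxA.
  rewrite u3 mul0mx !mulmx1 !mul1mx; move: (u *m u) => P.
  by apply/matrixP=> i j; rewrite !mxE; ring.
exists g; last by rewrite /glog gE addrAC subrr add0r tlog_exp.
apply/congr_subP; exists (x + (half * e) *: (x *m x)); rewrite gE; congr (_ + _).
rewrite scalerDr /u -scalemxAl -scalemxAr !scalerA; congr (_ + _ *: _); ring.
Qed.

Lemma glogJ (g s : gT) : glog (g ^ s)%g = invmx s *m glog g *m s.
Proof.
rewrite /glog GL_J -(tlogJ _ _ (GL_mulmxV s)); congr (tlog _ _).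
by rewrite mulmxBr mulmxBl mulmx1 GL_mulVmx.
Qed.

Lemma mod_cent_norm : S \subset 'N(K)%g.
Proof. exact: congruence_norm. Qed.

Lemma glog_charM : {in K &, forall g h, Psi (g * h)%g = Psi g * Psi h * b g h}.
Proof.
move=> g h Kg Kh; rewrite /Psi /b (glogM Kg Kh).
move: (glog g) (glog h) => u v; move: (u *m v - v *m u) => w.
by rewrite !mulmxDr !linearD /= !phiD -scalemxAr linearZ.
Qed.

(** The commutator term of [glog (g * h)] contributes only triple products of multiples of [e],
    which vanish. *)
Lemma pairingM : {in K & &, forall g h k, b (g * h)%g k = b g k * b h k}.
Proof.
move=> g h k Kg Kh Kk; rewrite /b -phiD glogM //.
have [[x ->] [y ->] [z ->]] := And3 (glogE Kg) (glogE Kh) (glogE Kk).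
have cz : (e *: x *m (e *: y) - e *: y *m (e *: x)) *m (e *: z) = 0.
  by rewrite mulmxBl !sc3 subrr.
have zc : (e *: z) *m (e *: x *m (e *: y) - e *: y *m (e *: x)) = 0.
  by rewrite mulmxBr !mulmxA !sc3 subrr.
move: (_ - _) cz zc => c cz zc; move: (e *: x) (e *: y) (e *: z) cz zc => u v w cw wc.
rewrite -mulrDr -mxtraceD -mulmxDr; congr (phi (_ * \tr (_ *m _))).
rewrite !mulmxDl !mulmxDr -scalemxAl -scalemxAr cw wc scaler0 !addr0.
by rewrite opprD addrACA.
Qed.

Lemma pairingC : {in K &, forall g h, b h g = (b g h)^-1}.
Proof.
move=> g h _ _; rewrite /b; move: (glog g) (glog h) => u v.
by rewrite -(opprB (u *m v)) mulmxN linearN mulrN phiN.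
Qed.

Lemma pairing_id : {in K, forall g, b g g = 1}.
Proof. by move=> g _; rewrite /b subrr mulmx0 linear0 mulr0 phi0. Qed.

Let tr_comm (u v : Mat) : \tr (M *m (u *m v - v *m u)) = \tr ((M *m u - u *m M) *m v).
Proof.
rewrite mulmxBr mulmxBl !linearB /= !mulmxA; congr (_ - _).
by rewrite -mulmxA mxtrace_mulC -mulmxA mxtrace_mulC.
Qed.

(** After multiplication by [e] the quadratic term of the logarithm disappears, so [g - 1] and
    [glog g] commute with [M] under the same condition. *)
Let glog_cent g : g \in K ->
  (g \in S) = (e *: (M *m glog g) == e *: (glog g *m M)).
Proof.
case/congr_subP=> x gx; rewrite inE /glog gx addrAC subrr add0r.
have elog : e *: tlog half (e *: x) = e *: (e *: x).
  rewrite /tlog scalerBr -scalemxAl -scalemxAr !scalerA.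
  set c := (X in _ - X *: _); have -> : c = half * e ^+ 3 by rewrite /c; ring.
  by rewrite e3 mulr0 scale0r subr0.
rewrite mulmxDl mulmxDr mulmx1 mul1mx !scalerDr (inj_eq (addrI _)).
by rewrite !(scalemxAr e M) !(scalemxAl e _ M) elog.
Qed.

Lemma pairing_rad : {in RM & K, forall z k, b z k = 1}.
Proof.
move=> z k; rewrite inE => /andP[Sz Kz] Kk; have [y kE] := glogE Kk.
move: Sz; rewrite glog_cent // => /eqP zM.
rewrite /b tr_comm kE -scalemxAr scalemxAl scalerBr zM subrr mul0mx linear0.
by rewrite mulr0 phi0.
Qed.

(** The square of [b g k] is [phi] of the trace of [[M, glog g]] times [glog k], and [glog k] runs
    over all multiples of [e]; nondegeneracy of the trace form applies. *)
Lemma pairing_rad2 :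
  {in K, forall g, (forall k, k \in K -> b k g ^+ 2 = 1) -> g \in RM}.
Proof.
move=> g Kg gK; rewrite inE Kg andbT glog_cent // -subr_eq0 -scalerBr; apply/eqP.
apply: phi_trace_nd => y; have [k Kk kE] := glog_onto y.
rewrite -scalemxAl scalemxAr -kE -tr_comm; transitivity (b g k ^+ 2).
  by rewrite /b expr2 -phiD -mulrDl half2 mul1r.
by rewrite pairingC // exprVn gK // invr1.
Qed.

(** Since [glog k] is a multiple of [e], only [M] modulo the annihilator of [e] matters, and [s]
    centralizes that. *)
Lemma glog_charJ : {in S & K, forall s k, Psi (k ^ s)%g = Psi k}.
Proof.
move=> s k Ss Kk; have [x kE] := glogE Kk; rewrite /Psi glogJ kE.
have sM : e *: (GLval s *m M *m invmx (GLval s)) = e *: M.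
  move: Ss; rewrite inE => /eqP sM.
  by rewrite scalemxAl -sM -scalemxAl -mulmxA GL_mulmxV mulmx1.
rewrite -[in RHS]scalemxAr [in RHS]scalemxAl -sM -scalemxAl scalemxAr !mulmxA.
by rewrite mxtrace_mulC !mulmxA.
Qed.

(** The orthogonal of [A] consists of the [X] for which [e *: X] is the logarithm of an element of
    [RM]. If [g] fixes [Psi] on [RM], then [D] is orthogonal to all of these, hence lies in [A] by
    duality. This makes the change of [M] under [g], seen after multiplication by [e], the effect of
    an element of [K]. *)
Lemma inertia_sub (g : gT) :
    (forall z, z \in RM -> Psi (z ^ g)%g = Psi z) -> g \in (S * K)%g.
Proof.
move=> gPsi; pose V := 'M[R]_N.-1.+1; pose pr (X Y : V) := phi (\tr (X *m Y)).
pose A : {set V} := [set X | [exists Y : V, X == e ^+ 2 *: (M *m Y - Y *m M)]].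
pose D : V := e *: (GLval g *m M *m invmx (GLval g) - M).
have A0 : 0 \in A.
  by rewrite inE; apply/existsP; exists 0; rewrite mulmx0 mul0mx subrr scaler0.
have AB X Y : X \in A -> Y \in A -> Y - X \in A.
  rewrite !inE => /existsP[X' /eqP->] /existsP[Y' /eqP->]; apply/existsP.
  exists (Y' - X'); rewrite -scalerBr mulmxBr mulmxBl.
  by rewrite !opprB addrACA [X in _ == _ *: X]addrAC !addrA.
have prDl (X Y Z : V) : pr (X + Y) Z = pr X Z * pr Y Z.
  by rewrite /pr mulmxDl linearD /= phiD.
have prC (X Y : V) : pr X Y = pr Y X by rewrite /pr mxtrace_mulC.
have pr0 (X : V) : pr 0 X = 1 by rewrite /pr mul0mx linear0 phi0.
have : D \in perp pr (perp pr A).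
  rewrite inE; apply/forall_inP=> X; rewrite inE => /forall_inP AX.
  have XM : e ^+ 2 *: (M *m X - X *m M) = 0.
    apply/eqP; rewrite -oppr_eq0 -scalerN opprB; apply/eqP/phi_trace_nd => Y.
    rewrite -[RHS](eqP (AX (e ^+ 2 *: (M *m Y - Y *m M)) _)); last first.
      by rewrite inE; apply/existsP; exists Y.
    rewrite /pr -!scalemxAl !linearZ /=; congr (phi (_ * _)).
    rewrite !mulmxBl !linearB /= -!mulmxA; congr (_ - _); first last.
      by rewrite [RHS]mxtrace_mulC !mulmxA.
    by rewrite [LHS]mxtrace_mulC !mulmxA.
  have [z Kz zX] := glog_onto X.
  have Sz : z \in S.
    rewrite glog_cent // zX -subr_eq0 -scalerBr -scalemxAr -scalemxAl -scalerBr.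
    by rewrite scalerA -expr2 XM.
  have /(_ _)/(congr1 (fun c => c * phi (- \tr (M *m (e *: X))))) := gPsi z.
  rewrite inE Sz Kz => /(_ isT); rewrite /Psi -!phiD zX subrr phi0 => gX.
  rewrite /pr -gX glogJ zX -raddfN -raddfD /=; apply/eqP; congr (phi _).
  rewrite [RHS]linearB /D /= -!(scalemxAr, scalemxAl) !linearZ /= -mulrBr.
  rewrite mulmxBr linearB /=; congr (_ * (_ - _)); last exact: mxtrace_mulC.
  by rewrite !mulmxA -mulmxA mxtrace_mulC !mulmxA mxtrace_mulC !mulmxA.
rewrite (perpK prDl pr0 prC phi_trace_nd A0 AB) inE => /existsP[Y /eqP DY].
(* To first order, conjugation by [1 - e Y] adds [e [M, Y]] to [M]; this is the change that [D]
   records. *)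
have [k kE] := congr_unit (- Y).
have Kk : k \in K by apply/congr_subP; exists (- Y).
have eq1 : e *: (GLval k *m M) = e *: (GLval g *m M *m invmx (GLval g) *m GLval k).
  transitivity ((e *: M + D) *m GLval k); last first.
    by rewrite -scalerDr addrCA subrr addr0 -scalemxAl.
  rewrite DY kE !mulmxDl !mulmxDr !mulmx1 mul1mx.
  rewrite -!(scalemxAl, scalemxAr) !scalerA -exprSr e3 scale0r addr0.
  rewrite mulNmx mulmxN; move: (M *m Y) (Y *m M) => P T.
  by apply/matrixP=> i j; rewrite !mxE; ring.
rewrite (normC mod_cent_norm); apply/mulsgP.
exists k (k^-1 * g)%g => //; last by rewrite mulKVg.
rewrite inE GL_MxE GL_VxE; apply/eqP.
have -> : e *: (M *m (invmx (GLval k) *m GLval g)) =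
    invmx (GLval k) *m (e *: (GLval k *m M)) *m invmx (GLval k) *m GLval g.
  by rewrite -!(scalemxAl, scalemxAr) !mulmxA GL_mulVmx mul1mx.
rewrite eq1 -!(scalemxAl, scalemxAr) !mulmxA -(mulmxA _ (GLval k)) GL_mulmxV mulmx1.
by rewrite -(mulmxA _ _ (GLval g)) GL_mulVmx mulmx1.
Qed.

(** The nonzero sum over [J] forces [R] to act through [Psi], so the Heisenberg extension to [S K]
    exists. An element fixing [sigma] preserves its support [RM] and the values of [Psi] there, so
    the inertia group lies in [S K] and the extension restricts to it. *)
Theorem congruence_extension (sigma : 'CF(K)) (J : {group gT}) (om : gT -> algC) :
    sigma \in irr K -> RM \subset J -> J \subset K ->
    \sum_(g in J) (Psi g)^-1 * sigma g != 0 ->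
    {in S &, {morph om : x y / (x * y)%g >-> x * y}} -> {in RM, om =1 Psi} ->
  exists2 st : 'CF('I_('GL_N[R])[sigma]), st \is a character & 'Res[K] st = sigma.
Proof.
move=> /irr_reprP[[d rK] /= irrK ->] sRJ sJK nz omM omR.
have nz' : \sum_(g in J) (Psi g)^-1 * \tr (rK g) != 0.
  apply: contraNneq nz => {2}<-; apply/eqP/eq_bigr => g Jg.
  by rewrite cfunE (subsetP sJK) // mulr1n.
have P0 : {in K, forall k, Psi k != 0} by move=> k _; apply: phi_n0.
have b0 : {in K &, forall g h, b g h != 0} by move=> g h _ _; apply: phi_n0.
have rKR := intertwined_scalar (erefl _) P0 glog_charM pairingM pairingC b0
  pairing_rad pairing_rad2 irrK sRJ sJK nz'.
have [rG rGK] := heisenberg_extension mod_cent_norm (erefl _) P0 glog_charM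
  pairingM pairingC pairing_id b0 pairing_rad pairing_rad2 glog_charJ irrK rKR omM omR.
have tr0 := tr_off_radical (erefl _) P0 glog_charM pairingM pairingC b0
  pairing_rad pairing_rad2 rKR.
have d0 : d%:R != 0 :> algC.
  by have [d_gt0 _] := (mx_irrP rK).1 irrK; rewrite pnatr_eq0 -lt0n.
have sIG : 'I_('GL_N[R])[cfRepr rK]%g \subset (S <*> K)%g.
  apply/subsetP=> g /setIP[_ Ig]; rewrite norm_joinEl ?mod_cent_norm //.
  apply: inertia_sub => z Rz; have Kz : z \in K := subsetP (subsetIr _ _) z Rz.
  have nKg : g \in 'N(K)%g by apply: subsetP (norm_inertia _) _ Ig.
  have Kzg : (z ^ g)%g \in K by rewrite memJ_norm.
  have := inertia_valJ z Ig; rewrite !cfunE Kz Kzg !mulr1n (rKR z Rz) mxtrace_scalar.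
  have dPsi : Psi z *+ d != 0 by rewrite -mulr_natr mulf_neq0 ?P0.
  (* A conjugate of [z] off [RM] would have trace 0, whereas [sigma z] is [d] times a nonzero
     number. *)
  have [Rzg|nRzg] := boolP ((z ^ g)%g \in RM).
    by rewrite (rKR _ Rzg) mxtrace_scalar -[LHS]mulr_natr -[RHS]mulr_natr => E; apply: (mulIf d0).
  by rewrite tr0 // => E; rewrite -E eqxx in dPsi.
exists (cfRepr (subg_repr rG sIG)); first exact: cfRepr_char.
have sKI : K \subset 'I_('GL_N[R])[cfRepr rK]%g.
  by apply: sub_Inertia; apply: subsetT.
apply/cfun_inP=> k Kk; rewrite cfResE // !cfunE Kk (subsetP sKI) //=.
by rewrite rGK.
Qed.

End MatrixHeisenberg.

(** * Linear characters of centralizers of Jordan matrices *)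

(** A constituent of the character induced from [f] is linear, and so is its restriction to [H];
    containing [f], that restriction equals it. *)
Lemma extend_abelian_char (gT : finGroupType) (G H : {group gT}) (f : gT -> algC) :
    abelian G -> H \subset G -> f 1%g = 1 ->
    {in H &, {morph f : x y / (x * y)%g >-> x * y}} ->
  exists F : gT -> algC,
    {in G &, {morph F : x y / (x * y)%g >-> x * y}} /\ {in H, F =1 f}.
Proof.
move=> cGG sHG f1 fM.
have rf : mx_repr H (fun x => (f x)%:M : 'M[algC]_1).
  by split=> [|x y Hx Hy]; rewrite ?f1 // fM // scalar_mxM.
pose lam := cfRepr (MxRepresentation rf).
have lamE x : x \in H -> lam x = f x by move=> Hx; rewrite cfunE Hx mxtrace_scalar.
have lin_lam : lam \is a linear_char.
  by rewrite qualifE /= cfRepr_char lamE ?f1 ?eqxx.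
have lam_irr := lin_char_irr lin_lam.
have [c cI] := constt_cfInd_irr (cfIirr lam) sHG.
have /char_abelianP/(_ c) lin_c := cGG.
have /irrP[k kE] := lin_char_irr (cfRes_lin_char H lin_c).
move: cI; rewrite constt_Ind_Res irr_consttE kE cfdot_irr pnatr_eq0 eqb0 negbK.
move=> /eqP kl; exists 'chi_c; split=> [|x Hx]; first exact: lin_charM.
by rewrite -lamE // -[lam]cfIirrE // -kl -kE cfResE.
Qed.

(** * Characters of determinants as traces of logarithms *)

Section DetLog.

Variables (R : comUnitRingType) (n : nat) (e half b : R).
Variables (phi theta : R -> algC).
Hypotheses (e3 : e ^+ 3 = 0) (half2 : half + half = 1).
Hypotheses (phi0 : phi 0 = 1) (phiD : forall x y, phi (x + y) = phi x * phi y).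
Hypothesis thetaM : {in GRing.unit &, {morph theta : x y / x * y}}.
Hypothesis theta_e : forall y,
  theta (1 + e * y) = phi (b * (e * y - half * (e * y) ^+ 2)).

Lemma det_add1_delta (c : R) (i j : 'I_n) :
  \det (1%:M + c *: delta_mx i j) = 1 + c *+ (i == j).
Proof.
rewrite -(mul_delta_mx (0 : 'I_1)) scalemxAl det_addmx1C -scalemxAr.
rewrite mul_delta_mx_cond det_mx11 !mxE eqxx eq_sym.
by case: eqP => _; rewrite /= !mxE ?mulr1 ?mulr0.
Qed.

Let good (X : 'M[R]_n) := theta (\det X) = phi (b * \tr (tlog half (X - 1%:M))).

Let phi_n0 x : phi x != 0.
Proof.
by apply/eqP=> x0; have /eqP := phi0; rewrite -(subrr x) phiD x0 mul0r eq_sym oner_eq0.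
Qed.

Let sc3 (x y z : 'M[R]_n) : (e *: x) *m (e *: y) *m (e *: z) = 0.
Proof. by rewrite -!(scalemxAl, scalemxAr) !scalerA -[e * (e * e)]/(e ^+ 3) e3 scale0r. Qed.

Let tr_tlogM (x y : 'M[R]_n) :
  \tr (tlog half ((1%:M + e *: x) *m (1%:M + e *: y) - 1%:M)) =
  \tr (tlog half (e *: x)) + \tr (tlog half (e *: y)).
Proof.
have -> : (1%:M + e *: x) *m (1%:M + e *: y) - 1%:M =
    e *: x + e *: y + (e *: x) *m (e *: y).
  by rewrite mulmxDl !mulmxDr !mulmx1 mul1mx addrAC [1%:M + _]addrC addrK addrCA addrA.
rewrite (tlogM half2); last first.
  by move=> a c d; rewrite !inE => /pred2P[]-> /pred2P[]-> /pred2P[]->; apply: sc3.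
move: (tlog half (e *: x)) (tlog half (e *: y)) => p q.
by rewrite 2!mxtraceD mxtraceZ raddfB /= [X in X - _]mxtrace_mulC subrr mulr0 addr0.
Qed.

Let goodM (x y : 'M[R]_n) : good (1%:M + e *: x) -> good (1%:M + e *: y) ->
  good ((1%:M + e *: x) *m (1%:M + e *: y)).
Proof.
have udet (z : 'M[R]_n) : \det (1%:M + e *: z) \is a GRing.unit.
  by rewrite -unitmxE; apply/unitmx_add1_nil/sc3.
rewrite /good => gx gy; rewrite det_mulmx thetaM ?udet // gx gy.
by rewrite ![1%:M + _ - 1%:M]addrAC subrr !add0r tr_tlogM mulrDr phiD.
Qed.

Let good_cancel (x y : 'M[R]_n) : good (1%:M + e *: y) ->
  good ((1%:M + e *: x) *m (1%:M + e *: y)) -> good (1%:M + e *: x).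
Proof.
have udet (z : 'M[R]_n) : \det (1%:M + e *: z) \is a GRing.unit.
  by rewrite -unitmxE; apply/unitmx_add1_nil/sc3.
rewrite /good => gy; rewrite det_mulmx thetaM ?udet // tr_tlogM.
rewrite gy mulrDr phiD ![1%:M + _ - 1%:M]addrAC subrr !add0r.
by move/(mulIf (phi_n0 _)).
Qed.

Let good1 : good 1%:M.
Proof.
have := theta_e 0; rewrite mulr0 addr0 expr0n mulr0 subr0 mulr0 => t1.
by rewrite /good det1 t1 subrr /tlog mulmx0 scaler0 subr0 linear0 mulr0.
Qed.

Let good_delta c i j : good (1%:M + e *: (c *: delta_mx i j)).
Proof.
have tr_delta : \tr (delta_mx i j : 'M[R]_n) = (i == j)%:R.
  rewrite -(mul_delta_mx (0 : 'I_1)) mxtrace_mulC mul_delta_mx_cond eq_sym.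
  by case: eqP; rewrite ?linear0 //= /mxtrace big_ord1 mxE.
rewrite /good scalerA det_add1_delta addrAC subrr add0r /tlog.
rewrite -scalemxAl -scalemxAr mul_delta_mx_cond raddfB /= !mxtraceZ.
rewrite (raddfMn (@mxtrace R n)) /= !tr_delta [j == i]eq_sym; case: eqP => _.
  rewrite !mulr1n !mulr1 theta_e; congr (phi (b * (_ - _))); ring.
by have := good1; rewrite /good det1 subrr /tlog mulmx0 scaler0 subr0 !mulr0n !mulr0
  subr0 mulr0 linear0 mulr0 addr0.
Qed.

(** Both sides are multiplicative on [1 + e M_n], so no expansion of the determinant is required: it
    suffices to treat [1 + e c E_ij], first for multiples of [e ^+ 2], then in general. *)
Lemma det_log (x : 'M[R]_n) :
  theta (\det (1%:M + e *: x)) = phi (b * \tr (tlog half (e *: x))).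
Proof.
suff : good (1%:M + e *: x) by rewrite /good addrAC subrr add0r.
have ind (c : R) : (forall y z, good (1%:M + e *: (c *: y)) ->
    good (1%:M + e *: (c *: z)) -> good (1%:M + e *: (c *: (y + z)))) ->
    forall y, good (1%:M + e *: (c *: y)).
  move=> cD y; rewrite [y]matrix_sum_delta.
  have c0 : good (1%:M + e *: (c *: 0)) by rewrite !scaler0 addr0; apply: good1.
  apply: (big_ind (fun z => good (1%:M + e *: (c *: z)))) => // i _.
  apply: (big_ind (fun z => good (1%:M + e *: (c *: z)))) => // j _.
  by rewrite [c *: _]scalerA; apply: good_delta.
(* Here sums turn into products exactly, as the cross term carries [e ^+ 4 = 0]. *)
have good2 : forall y, good (1%:M + e *: (e *: y)).
  apply: ind => y z gy gz; suff -> : 1%:M + e *: (e *: (y + z)) =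
    (1%:M + e *: (e *: y)) *m (1%:M + e *: (e *: z)) by apply: goodM.
  rewrite mulmxDl mul1mx mulmxDr mulmx1 -!(scalemxAl, scalemxAr) !scalerA.
  set c := (X in X *: (y *m z)); have -> : c = e * e ^+ 3 by rewrite /c; ring.
  by rewrite e3 mulr0 scale0r addr0; apply/matrixP=> i j; rewrite !mxE; ring.
suff good3 : forall y, good (1%:M + e *: (1 *: y)) by have := good3 x; rewrite scale1r.
apply: ind => y z; rewrite !scale1r => gy gz.
have u := unitmx_add1_nil (sc3 (y + z) (y + z) (y + z)).
have := goodM gy gz.
(* In general the sum and the product differ by a factor [1 + e ^ 2 w], already covered by
   [good2]. *)
set w := invmx (1%:M + e *: (y + z)) *m (y *m z).
suff -> : (1%:M + e *: y) *m (1%:M + e *: z) =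
    (1%:M + e *: (y + z)) *m (1%:M + e *: (e *: w)) by apply: good_cancel.
rewrite [RHS]mulmxDr mulmx1 -2!scalemxAr /w mulKVmx //.
rewrite mulmxDl !mulmxDr !mulmx1 !mul1mx -scalemxAl -scalemxAr.
by move: (y *m z) => q; apply/matrixP=> i j; rewrite !mxE; ring.
Qed.

End DetLog.

Lemma sum_unique (R : pzSemiRingType) (I : finType) (P : pred I) (F : I -> R) :
  (forall i j, P i -> P j -> i = j) ->
  \sum_i (P i)%:R * F i = oapp F 0 [pick i | P i].
Proof.
move=> uP; case: pickP => [i Pi|P0] /=; last by rewrite big1 // => i _; rewrite P0 mul0r.
rewrite (bigD1 i) //= Pi mul1r big1 ?addr0 // => j /negP ji.
by case Pj: (P j); rewrite ?mul0r //; case: ji; rewrite (uP _ _ Pi Pj).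
Qed.

(* A matrix in Jordan form is described by its diagonal D and by the label h i of
   the Jordan block containing the index i. *)
Section Bidiagonal.

Variables (R : comUnitRingType) (n : nat) (D : 'I_n -> R) (h : 'I_n -> nat).
Hypothesis h_mono : forall i j : 'I_n, (i <= j)%N -> (h i <= h j)%N.
Hypothesis hD : forall i j, h i = h j -> D i = D j.
Hypothesis unitD : forall i j, D i != D j -> D i - D j \is a GRing.unit.

Definition bidiag : 'M[R]_n :=
  \matrix_(i, j) (D i *+ (i == j) + ((i.+1 == j :> nat) && (h i == h j))%:R).

Local Notation A := bidiag.

Let linked (i j : 'I_n) : bool := (i.+1 == j :> nat) && (h i == h j).
(** [next] is [None] at the end of a Jordan block and [prev] at its start; [oapp] then supplies the
    entry 0. *)
Let next (i : 'I_n) := [pick k | linked i k].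
Let prev (j : 'I_n) := [pick k | linked k j].

Lemma mul_bidiag (X : 'M[R]_n) i j :
  (A *m X) i j = D i * X i j + oapp (X^~ j) 0 (next i).
Proof.
rewrite mxE; under eq_bigr => k _ do rewrite mxE mulrDl.
rewrite big_split /= (bigD1 i) //= eqxx mulr1n big1 ?addr0 => [|k ki]; last first.
  by rewrite eq_sym (negPf ki) mul0r.
congr (_ + _); rewrite -(sum_unique (P := linked i) (X^~ j)) // => k k'.
by move=> /andP[/eqP ik _] /andP[/eqP ik' _]; apply: ord_inj; rewrite -ik -ik'.
Qed.

Lemma mul_mx_bidiag (X : 'M[R]_n) i j :
  (X *m A) i j = D j * X i j + oapp (X i) 0 (prev j).
Proof.
rewrite mxE; under eq_bigr => k _ do rewrite mxE mulrDr.
rewrite big_split /= (bigD1 j) //= eqxx mulr1n big1 ?addr0 => [|k ki]; last first.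
  by rewrite (negPf ki) mulr0n mulr0.
rewrite mulrC; congr (_ + _); rewrite -(sum_unique (P := fun k => linked k j) (X i)).
  by apply: eq_bigr => k _; rewrite mulrC.
move=> k k' /andP[/eqP ik _] /andP[/eqP ik' _]; apply: ord_inj.
by apply: succn_inj; rewrite ik ik'.
Qed.

(** The relation at [(i, j)] expresses [(D i - D j) X_ij] through the entries just below and just to
    the left, so induction starts from the lower left corner. *)
Lemma comm_bidiag_diff (X : 'M[R]_n) i j : X *m A = A *m X -> D i != D j -> X i j = 0.
Proof.
move=> XA; have [m] := ubnP (j + (n - i)); elim: m => // m IHm in i j * => le_m Dij.
have := congr1 (fun Y : 'M_n => Y i j) XA; rewrite /= mul_bidiag mul_mx_bidiag.
have -> : oapp (X^~ j) 0 (next i) = 0.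
  rewrite /next; case: pickP => [k /andP[/eqP ik /eqP hk]|] //=.
  apply: IHm; last by rewrite -(hD hk).
  by have := ltn_ord k; lia.
have -> : oapp (X i) 0 (prev j) = 0.
  rewrite /prev; case: pickP => [k /andP[/eqP ik /eqP hk]|] //=.
  by apply: IHm; [lia | rewrite (hD hk)].
rewrite !addr0 => /eqP; rewrite -subr_eq0 -mulrBl -oppr_eq0 -mulNr opprB => /eqP.
by move/(canRL (mulKr (unitD Dij))); rewrite mulr0.
Qed.

Lemma comm_bidiagP (X : 'M[R]_n) :
  X *m A = A *m X <->
  forall i j, if D i == D j then oapp (X^~ j) 0 (next i) = oapp (X i) 0 (prev j)
              else X i j = 0.
Proof.
split=> [XA i j|XA].
  case: ifPn => [/eqP Dij|]; last exact: comm_bidiag_diff.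
  have := congr1 (fun Y : 'M_n => Y i j) XA; rewrite /= mul_bidiag mul_mx_bidiag Dij.
  by move/addrI.
apply/matrixP=> i j; rewrite mul_bidiag mul_mx_bidiag; have := XA i j.
case: ifPn => [/eqP -> -> //|Dij Xij]; rewrite Xij !mulr0 !add0r.
have -> : oapp (X^~ j) 0 (next i) = 0.
  rewrite /next; case: pickP => [k /andP[_ /eqP hk]|] //=.
  by have := XA k j; rewrite -(hD hk) (negPf Dij).
rewrite /prev; case: pickP => [k /andP[_ /eqP hk]|] //=.
by have := XA i k; rewrite (hD hk) (negPf Dij).
Qed.

(* The commutation relations only equate entries to one another or to 0. *)
Lemma comm_bidiag_map (X : 'M[R]_n) (t : R -> R) :
  t 0 = 0 -> X *m A = A *m X -> map_mx t X *m A = A *m map_mx t X.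
Proof.
move=> t0 /comm_bidiagP XA; apply/comm_bidiagP=> i j; have := XA i j.
case: ifP => _; last by rewrite mxE => ->.
move/(congr1 t).
by case: (next i) => [k|]; case: (prev j) => [k'|]; rewrite /= ?mxE ?t0.
Qed.

(** Commutation equates [X_ij] with the next entry down the diagonal. Below the main diagonal the
    row index reaches the end of its block first, where the entry must be 0. *)
Lemma comm_bidiag_lower (X : 'M[R]_n) i j :
  X *m A = A *m X -> h i = h j -> (j < i)%N -> X i j = 0.
Proof.
move=> /comm_bidiagP XA; have [m] := ubnP (n - i); elim: m => // m IHm in i j *.
move=> le_m hij ji; have j1 : (j.+1 < n)%N by have := ltn_ord i; lia.
pose j' := Ordinal j1; have hj' : h j' = h j.
  by have := h_mono (leqnSn j : j <= j')%N; have := h_mono (ji : j' <= i)%N; lia.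
have := XA i j'; rewrite (@hD i j') ?eqxx; last by rewrite hj'.
have -> : prev j' = Some j.
  rewrite /prev; case: pickP => [k /andP[/eqP[kj] _]|/(_ j)]; last by rewrite /linked hj' !eqxx.
  by congr Some; apply: ord_inj.
move=> /= <-; rewrite /next; case: pickP => [k /andP[/eqP ik /eqP hk]|] //=.
by apply: IHm => //=; [have := ltn_ord k | rewrite -hk hij hj' | rewrite -ik]; lia.
Qed.

Definition block_proj (a : nat) : 'M[R]_n := diag_mx (\row_i (h i == a)%:R).
Definition eigen_proj (a : R) : 'M[R]_n := diag_mx (\row_i (D i == a)%:R).

Lemma comm_block_proj a : block_proj a *m A = A *m block_proj a.
Proof.
apply/matrixP=> i j; rewrite mul_diag_mx mul_mx_diag !mxE [RHS]mulrC.
have [-> //|hij] := eqVneq (h i) (h j).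
have /negPf -> : i != j by apply: contraNneq hij => ->.
by rewrite andbF addr0 !mulr0.
Qed.

Lemma comm_eigen_proj X a : X *m A = A *m X -> eigen_proj a *m X = X *m eigen_proj a.
Proof.
move=> XA; apply/matrixP=> i j; rewrite mul_diag_mx mul_mx_diag !mxE [RHS]mulrC.
have [-> //|Dij] := eqVneq (D i) (D j).
by rewrite (comm_bidiag_diff XA Dij) !mulr0.
Qed.

Lemma eigen_proj_idem a : eigen_proj a *m eigen_proj a = eigen_proj a.
Proof.
rewrite /eigen_proj mulmx_diag; congr diag_mx; apply/rowP=> i; rewrite !mxE.
by case: eqP; rewrite ?mulr1 ?mulr0.
Qed.

(* e_sl, with s the first index of a block and l the last index of a block for the
   same eigenvalue *)
Lemma comm_delta s l : D s = D l -> prev s = None -> next l = None ->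
  delta_mx s l *m A = A *m delta_mx s l.
Proof.
move=> Dsl ps nl; apply/comm_bidiagP=> i j; case: ifPn => [_|Dij]; last first.
  rewrite mxE; case: andP => // -[/eqP Ei /eqP Ej].
  by rewrite Ei Ej Dsl eqxx in Dij.
have -> : oapp ((delta_mx s l : 'M[R]_n)^~ j) 0 (next i) = 0.
  rewrite /next; case: pickP => [k ik|] //=; rewrite mxE; case: eqP => //= ks.
  by move: ps; rewrite /prev; case: pickP => // /(_ i); rewrite -ks ik.
rewrite /prev; case: pickP => [k kj|] //=; rewrite mxE andbC; case: eqP => //= kl.
by move: nl; rewrite /next; case: pickP => // /(_ j); rewrite -kl kj.
Qed.

Lemma block_start i : exists s, [/\ h s = h i, prev s = None & (s <= i)%N].
Proof.
case: (arg_minnP (P := fun k => h k == h i) (fun k : 'I_n => k : nat) (eqxx (h i))).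
move=> s /eqP hs mins; exists s; split=> //; last exact: mins.
rewrite /prev; case: pickP => // k /andP[/eqP ks /eqP hk].
by have := mins k; rewrite hk hs eqxx => /(_ isT); lia.
Qed.

Lemma block_end i : exists l, [/\ h l = h i, next l = None & (i <= l)%N].
Proof.
case: (arg_maxnP (P := fun k => h k == h i) (fun k : 'I_n => k : nat) (eqxx (h i))).
move=> s /eqP hs maxs; exists s; split=> //; last exact: maxs.
rewrite /next; case: pickP => // k /andP[/eqP ks /eqP hk].
by have := maxs k; rewrite -hk hs eqxx => /(_ isT); lia.
Qed.

Section Center.

Variables (e : R) (T : 'M[R]_n).
Hypothesis TA : e *: (T *m A) = e *: (A *m T).
Hypothesis TC : forall X : 'M[R]_n, X *m A = A *m X -> e *: (T *m X) = e *: (X *m T).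

Let Y := e *: T.

Let YA : Y *m A = A *m Y. Proof. by rewrite -scalemxAl TA -scalemxAr. Qed.
Let YC X : X *m A = A *m X -> Y *m X = X *m Y.
Proof. by move=> XA; rewrite -scalemxAl TC // -scalemxAr. Qed.

Let Y_block i j : h i != h j -> Y i j = 0.
Proof.
move=> hij; have := YC (comm_block_proj (h i)).
move/(congr1 (fun Z : 'M_n => Z i j)); rewrite /= mul_diag_mx mul_mx_diag !mxE.
by rewrite eqxx mul1r [h j == _]eq_sym (negPf hij) mulr0.
Qed.

(** Commuting with a single Jordan block makes [Y] constant along the diagonal of that block. *)
Let Y_diag_block i j : h i = h j -> (i <= j)%N -> Y i i = Y j j.
Proof.
move=> + ij; have [m] := ubnP (j - i); elim: m => // m IHm in i ij *.
move=> le_m hij; have [ij_eq|ij_neq] := eqVneq (i : nat) j.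
  by congr (Y _ _); apply: ord_inj.
have i1 : (i.+1 < n)%N by have := ltn_ord j; lia.
pose i' := Ordinal i1; have hi' : h i' = h i.
  have i'j : (i' <= j)%N by rewrite /=; lia.
  by have := h_mono (leqnSn i : i <= i')%N; have := h_mono i'j; lia.
rewrite -(IHm i'); [|rewrite /=; lia..|by rewrite hi'].
have /comm_bidiagP/(_ i i') := YA; rewrite (hD hi') eqxx.
have -> : next i = Some i'.
  rewrite /next; case: pickP => [k /andP[/eqP ik _]|/(_ i')]; last by rewrite /linked hi' !eqxx.
  by congr Some; apply: ord_inj.
have -> : prev i' = Some i.
  rewrite /prev; case: pickP => [k /andP[/eqP[ik] _]|/(_ i)]; last by rewrite /linked hi' !eqxx.
  by congr Some; apply: ord_inj.
by [].
Qed.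

(** Blocks with the same eigenvalue are linked by the elementary matrix from the start of one to the
    end of the other; [Y] commutes with it, which equates their diagonal values. *)
Lemma center_diag i j : D i = D j -> e * T i i = e * T j j.
Proof.
move=> Dij; have [s [hs ps si]] := block_start i; have [l [hl nl jl]] := block_end j.
have Dsl : D s = D l by rewrite (hD hs) Dij (hD hl).
have /(congr1 (fun Z : 'M_n => Z s l)) := YC (comm_delta Dsl ps nl).
have -> : (Y *m delta_mx s l) s l = Y s s.
  rewrite mxE (bigD1 s) //= [delta_mx _ _ _ _]mxE !eqxx mulr1 big1 ?addr0 // => k ks.
  by rewrite [delta_mx _ _ _ _]mxE (negPf ks) mulr0.
have -> : (delta_mx s l *m Y) s l = Y l l.
  rewrite mxE (bigD1 l) //= [delta_mx _ _ _ _]mxE !eqxx mul1r big1 ?addr0 // => k kl.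
  by rewrite [delta_mx _ _ _ _]mxE (negPf kl) andbF mul0r.
by rewrite (Y_diag_block hs si) -(Y_diag_block (esym hl) jl) !mxE.
Qed.

(** [Y] is block diagonal, and within each block both [Y] and [e *: X] are upper triangular; hence
    only diagonal products survive in the trace. *)
Lemma center_trace (X : 'M[R]_n) : e *: (X *m A) = e *: (A *m X) ->
  e * \tr (T *m X) = e * \sum_i T i i * X i i.
Proof.
move=> XA; have eXA : (e *: X) *m A = A *m (e *: X) by rewrite -scalemxAl XA scalemxAr.
rewrite /mxtrace !mulr_sumr; apply: eq_bigr => i _; rewrite mxE mulr_sumr.
rewrite (bigD1 i) //= big1 ?addr0 // => j ji.
have [hij|/Y_block] := eqVneq (h i) (h j); last first.
  by rewrite mxE => E; rewrite mulrA E mul0r.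
have [lij|lji|/ord_inj eij] := ltngtP i j; last by rewrite eij eqxx in ji.
  have := comm_bidiag_lower eXA (esym hij) lij; rewrite mxE => E.
  by rewrite mulrCA E mulr0.
by have := comm_bidiag_lower YA hij lji; rewrite mxE => E; rewrite mulrA E mul0r.
Qed.

End Center.

End Bidiagonal.

(** * A linear character of the centralizer of a stable matrix in Jordan form *)

Section JordanCharacter.

Variables (R : finComUnitRingType) (N : nat).
Variables (D : 'I_N.-1.+1 -> R) (h : 'I_N.-1.+1 -> nat).
Hypothesis h_mono : forall i j : 'I_N.-1.+1, (i <= j)%N -> (h i <= h j)%N.
Hypothesis hD : forall i j, h i = h j -> D i = D j.
Hypothesis unitD : forall i j, D i != D j -> D i - D j \is a GRing.unit.

Local Notation Mat := 'M[R]_N.-1.+1.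
Local Notation gT := {'GL_N[R]}.
Local Notation A := (bidiag D h).

Variables (e half w : R) (B : Mat) (phi : R -> algC).
Hypotheses (e3 : e ^+ 3 = 0) (half2 : half + half = 1).
Hypothesis ann_sqr : forall y z, e * y = 0 -> e * z = 0 -> y * z = 0.
Hypothesis ann_sub : forall y, e * y = 0 -> exists z, y = e * z.
Hypothesis nil_w : exists m, w ^+ m = 0.
Hypotheses (phi0 : phi 0 = 1) (phiD : forall x y, phi (x + y) = phi x * phi y).
Hypothesis BA : e *: (B *m A) = e *: (A *m B).
Hypothesis BC :
  forall X : Mat, e *: (X *m A) = e *: (A *m X) -> e *: (B *m X) = e *: (X *m B).

(** With [w] the uniformizer this is the stable form [A + pi B]; the conditions on [B] hold only
    after multiplication by [e]. *)
Let T : Mat := A + w *: B.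

Let TA : e *: (T *m A) = e *: (A *m T).
Proof.
rewrite mulmxDl mulmxDr -scalemxAl -scalemxAr !scalerDr !scalerA [e * w]mulrC.
by rewrite -!scalerA BA.
Qed.

Let TC' (X : Mat) : e *: (X *m A) = e *: (A *m X) -> e *: (T *m X) = e *: (X *m T).
Proof.
move=> XA; rewrite mulmxDl mulmxDr -scalemxAl -scalemxAr !scalerDr !scalerA [e * w]mulrC.
by rewrite -!scalerA BC // XA.
Qed.

Let TC (X : Mat) : X *m A = A *m X -> e *: (T *m X) = e *: (X *m T).
Proof. by move=> XA; apply: TC'; rewrite XA. Qed.

(** Descent on the power of the nilpotent [w]: if [w Z] commutes with [A], then [B] commutes with
    [w Z], and removing [w B] from [T] shows that [Z] commutes with [A]. *)
Let TC_inv (X : Mat) : e *: (X *m T) = e *: (T *m X) -> e *: (X *m A) = e *: (A *m X).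
Proof.
move=> XT; have [m wm] := nil_w.
suff P k : (k <= m)%N ->
    e *: ((w ^+ (m - k) *: X) *m A) = e *: (A *m (w ^+ (m - k) *: X)).
  by have := P m (leqnn m); rewrite subnn expr0 scale1r.
elim: k => [|k IHk] km; first by rewrite subn0 wm scale0r mul0mx mulmx0.
have /BC := IHk (ltnW km).
have -> : (m - k = (m - k.+1).+1)%N by lia.
move: (m - k.+1)%N => p; rewrite exprS -scalerA; set Z := w ^+ p *: X => BX.
have : e *: (Z *m T) = e *: (T *m Z).
  by rewrite -scalemxAl -scalemxAr scalerA mulrC -scalerA XT scalerA mulrC -scalerA.
rewrite mulmxDl mulmxDr !scalerDr -scalemxAr -scalemxAl.
by move: BX; rewrite -scalemxAl -scalemxAr => ->; move/addIr.
Qed.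

Lemma mod_cent_jordan : mod_cent (N := N) e T = mod_cent e A.
Proof.
apply/setP=> g; rewrite !inE; apply/eqP/eqP => E; apply/esym.
  exact: TC_inv.
by apply/esym/TC'.
Qed.

(** A chosen quotient by [c]. It need not be additive; sending 0 to 0 is what [comm_bidiag_map] asks
    for. *)
Let div_by (c y : R) : R := if y == 0 then 0 else odflt 0 [pick z | y == c * z].

Let div_by0 c : div_by c 0 = 0. Proof. by rewrite /div_by eqxx. Qed.

Let div_byK c z : c * div_by c (c * z) = c * z.
Proof.
rewrite /div_by; case: eqP => [->|_]; first by rewrite mulr0.
by case: pickP => [z' /eqP <-|/(_ z)] //=; rewrite eqxx.
Qed.

Lemma lift_centralizer c (X : Mat) : c *: (X *m A) = c *: (A *m X) ->
  exists2 X', X' *m A = A *m X' & c *: X' = c *: X.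
Proof.
move=> XA; exists (map_mx (div_by c) (c *: X)).
  by apply: comm_bidiag_map => //; rewrite -scalemxAl XA scalemxAr.
by apply/matrixP=> i j; rewrite !mxE div_byK.
Qed.

(** The diagonal value of [T] on the generalized eigenspace for [a], well defined after
    multiplication by [e]; 0 when [a] is no eigenvalue. *)
Let b (a : R) : R := if [pick i | D i == a] is Some i then T i i else 0.

Let b_diag i : e * b (D i) = e * T i i.
Proof.
rewrite /b; case: pickP => [j /eqP Dj|/(_ i)]; last by rewrite eqxx.
exact: (center_diag h_mono hD unitD TA TC Dj).
Qed.

Let eE (a : R) : Mat := eigen_proj D a.

Let eigen_trace (Z : Mat) : e *: (Z *m A) = e *: (A *m Z) ->
  \sum_a b a * \tr (e *: (Z *m eE a)) = \tr (T *m (e *: Z)).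
Proof.
move=> ZA; rewrite -scalemxAr linearZ /= (center_trace h_mono hD unitD TA TC ZA) mulr_sumr.
under eq_bigr => a _ do rewrite linearZ /= /mxtrace mulr_sumr mulr_sumr.
rewrite exchange_big /=; apply: eq_bigr => i _.
have ZE a : (Z *m eE a) i i = Z i i * (D i == a)%:R by rewrite mul_mx_diag !mxE.
rewrite (bigD1 (D i)) //= big1 ?addr0 => [|a aD]; last first.
  by rewrite ZE eq_sym (negPf aD) !mulr0.
by rewrite ZE eqxx mulr1 mulrA [b _ * e]mulrC b_diag mulrA.
Qed.

(** The truncated logarithm is additive on [1 + e R], so [phi (b a * log)] is a character there, and
    it extends to the finite abelian group of units. *)
Let theta_ex a : exists th : R -> algC,
  {in GRing.unit &, {morph th : x y / x * y}} /\
  forall y, th (1 + e * y) = phi (b a * (e * y - half * (e * y) ^+ 2)).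
Proof.
pose tl x : R := x - half * x ^+ 2.
pose H := [set u : {unit R} | [exists y, val u == 1 + e * y]].
have gH : group_set H.
  apply/group_setP; split=> [|u v].
    by rewrite inE; apply/existsP; exists 0; rewrite mulr0 addr0.
  rewrite !inE => /existsP[x /eqP ux] /existsP[y /eqP vy]; apply/existsP.
  exists (x + y + e * (x * y)); rewrite FinRing.val_unitM ux vy; apply/eqP; ring.
pose f (u : {unit R}) := phi (b a * tl (val u - 1)).
have f1 : f 1%g = 1.
  by rewrite /f FinRing.val_unit1 subrr /tl expr0n mulr0 subr0 mulr0 phi0.
have fM : {in Group gH &, {morph f : u v / (u * v)%g >-> u * v}}.
  move=> u v; rewrite !inE => /existsP[x /eqP ux] /existsP[y /eqP vy].
  rewrite /f FinRing.val_unitM ux vy -phiD -mulrDr /tl; congr (phi (_ * _)).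
  set l := LHS; set r := RHS.
  have -> : l = r + (1 - (half + half)) * (e * x * (e * y))
     - half * e ^+ 3 * (2%:R * x ^+ 2 * y + 2%:R * x * y ^+ 2 + e * x ^+ 2 * y ^+ 2).
    by rewrite /l /r; ring.
  by rewrite half2 e3 subrr mul0r addr0 mulr0 mul0r subr0.
have cU : abelian [set: {unit R}].
  by apply/centsP=> u _ v _; apply: val_inj; rewrite !FinRing.val_unitM mulrC.
have [F [FM FH]] := extend_abelian_char cU (subsetT (Group gH)) f1 fM.
exists (fun x => F (insubd (1%g : {unit R}) x)); split=> [x y ux uy|y].
  rewrite -FM ?inE //; congr F; apply: val_inj.
  by rewrite FinRing.val_unitM !val_insubd ux uy unitrM ux uy.
have ue : 1 + e * y \is a GRing.unit.
  apply/unitrPr; exists (1 - e * y + (e * y) ^+ 2).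
  have -> : (1 + e * y) * (1 - e * y + (e * y) ^+ 2) = 1 + e ^+ 3 * y ^+ 3 by ring.
  by rewrite e3 mul0r addr0.
rewrite FH.
  by rewrite /f val_insubd ue addrAC subrr add0r.
by rewrite inE; apply/existsP; exists y; rewrite val_insubd ue.
Qed.

(** The determinant of [X] on the generalized eigenspace for [a], when [X] commutes with [A]. *)
Let edet a (X : Mat) := \det (X *m eE a + (1%:M - eE a)).

Let eE_idem a : eE a *m eE a = eE a. Proof. exact: eigen_proj_idem. Qed.

Let eEf a : eE a *m (1%:M - eE a) = 0.
Proof. by rewrite mulmxBr mulmx1 eE_idem subrr. Qed.

Let efE a : (1%:M - eE a) *m eE a = 0.
Proof. by rewrite mulmxBl mul1mx eE_idem subrr. Qed.

Let edetM a (X Y : Mat) : Y *m A = A *m Y -> edet a (X *m Y) = edet a X * edet a Y.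
Proof.
move=> YA; have EY : eE a *m Y = Y *m eE a := comm_eigen_proj hD unitD a YA.
rewrite /edet -det_mulmx idem_pencilM ?eEf ?efE ?eE_idem //.
  by rewrite mulmxBl mul1mx eEf subr0.
by rewrite mulmxBl mulmxBr mulmx1 mul1mx EY.
Qed.

Let edet1 a : edet a 1%:M = 1.
Proof. by rewrite /edet mul1mx addrCA subrr addr0 det1. Qed.

Let edet_unit a (g : gT) : GLval g *m A = A *m GLval g -> edet a (GLval g) \is a GRing.unit.
Proof.
move=> gA; apply/unitrPr; exists (edet a (invmx (GLval g))).
rewrite -edetM ?GL_mulmxV ?edet1 //.
by rewrite -[LHS]mulmx1 -(GL_mulmxV g) mulmxA -(mulmxA _ A) -gA mulmxA GL_mulVmx mul1mx.
Qed.

Let edet_log a th (x : Mat) :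
    {in GRing.unit &, {morph th : x y / x * y}} ->
    (forall y, th (1 + e * y) = phi (b a * (e * y - half * (e * y) ^+ 2))) ->
  th (edet a (1%:M + e *: x)) = phi (b a * \tr (tlog half (e *: (x *m eE a)))).
Proof.
move=> thM the; rewrite -(det_log e3 half2 phi0 phiD thM the); congr (th (\det _)).
by rewrite mulmxDl mul1mx -scalemxAl addrC addrA subrK.
Qed.

(** The group is the product of the exact centralizer [C] of [A] and the kernel [L] of reduction
    modulo the annihilator of [e]. On [C] the character is a product of characters of eigenspace
    determinants, on [L] it is [phi] of a trace; they agree on the intersection and glue. *)
Theorem jordan_linear_char : exists om : gT -> algC,
  {in mod_cent e T &, {morph om : x y / (x * y)%g >-> x * y}} /\
  {in mod_cent e T :&: congruence_subgroup N e, om =1 glog_char half phi T}.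
Proof.
have /fin_all_exists[th thP] := theta_ex.
pose C := [group of mod_cent (N := N) 1 A].
have CE (g : gT) : (g \in C) = (GLval g *m A == A *m GLval g).
  by rewrite inE !scale1r eq_sym.
pose L := [set g : gT | e *: (GLval g - 1%:M) == 0].
have annM (X Y : Mat) : e *: X = 0 -> e *: Y = 0 -> X *m Y = 0.
  move=> X0 Y0; apply/matrixP=> i j; rewrite !mxE big1 // => k _; apply: ann_sqr.
    by have /matrixP/(_ i k) := X0; rewrite !mxE.
  by have /matrixP/(_ k j) := Y0; rewrite !mxE.
have annE (X : Mat) : e *: X = 0 -> exists Y, X = e *: Y.
  move=> X0; exists (\matrix_(i, j) odflt 0 [pick z | X i j == e * z]).
  apply/matrixP=> i j; rewrite !mxE.
  have [|z Xz] := @ann_sub (X i j); first by have /matrixP/(_ i j) := X0; rewrite !mxE.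
  by case: pickP => [z' /eqP->|/(_ z)] //=; rewrite Xz eqxx.
have gL : group_set L.
  apply/group_setP; split=> [|g k]; first by rewrite inE GL_1E subrr scaler0.
  rewrite !inE GL_MxE => /eqP g0 /eqP k0.
  have -> : GLval g *m GLval k - 1%:M =
      GLval g *m (GLval k - 1%:M) + (GLval g - 1%:M).
    by rewrite mulmxBr mulmx1 addrA subrK.
  by rewrite scalerDr g0 addr0 scalemxAr k0 mulmx0.
pose om1 (g : gT) := \prod_a th a (edet a (GLval g)).
pose om2 (g : gT) := phi (\tr (T *m (GLval g - 1%:M))).
have nL : C \subset 'N(Group gL)%g.
  apply/subsetP=> s _; rewrite inE; apply/subsetP=> _ /imsetP[g + ->].
  rewrite !inE GL_J => /eqP g0; apply/eqP.
  have -> : invmx (GLval s) *m GLval g *m GLval s - 1%:M =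
      invmx (GLval s) *m (GLval g - 1%:M) *m GLval s.
    by rewrite mulmxBr mulmxBl mulmx1 GL_mulVmx.
  by rewrite scalemxAl scalemxAr g0 mulmx0 mul0mx.
have th1 a : th a 1 = 1.
  by have := (thP a).2 0; rewrite mulr0 addr0 => ->; rewrite expr0n mulr0 subr0 mulr0 phi0.
have om1_1 : om1 1%g = 1.
  by rewrite /om1 big1 // => a _; rewrite GL_1E edet1.
have om1M : {in C &, {morph om1 : x y / (x * y)%g >-> x * y}}.
  move=> g k; rewrite !CE => /eqP gA /eqP kA; rewrite /om1 GL_MxE -big_split /=.
  by apply: eq_bigr => a _; rewrite edetM // (thP a).1 //; apply: edet_unit.
have om2M : {in Group gL &, {morph om2 : x y / (x * y)%g >-> x * y}}.
  move=> g k; rewrite !inE => /eqP g0 /eqP k0; rewrite /om2 -phiD GL_MxE; congr phi.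
  rewrite -linearD -mulmxDr /=; congr (\tr (_ *m _)).
  have := annM _ _ g0 k0; rewrite mulmxBl mul1mx mulmxBr mulmx1 => /eqP.
  by rewrite subr_eq0 => /eqP <-; rewrite [RHS]addrC addrA subrK.
have prod_phi (F : R -> R) : \prod_a phi (F a) = phi (\sum_a F a).
  by apply: esym; apply: (big_morph phi phiD phi0).
(* On [L] the square of [g - 1] vanishes, so the logarithm is just [g - 1]. *)
have om12 : {in C :&: Group gL, om1 =1 om2}.
  move=> g; rewrite !inE !scale1r => /andP[/eqP gA /eqP g0].
  have [y yE] := annE _ g0.
  have gE : GLval g = 1%:M + e *: y by rewrite -yE addrCA subrr addr0.
  rewrite /om1 /om2 yE -eigen_trace; last first.
    by rewrite scalemxAl scalemxAr -yE mulmxBl mulmxBr mul1mx mulmx1 gA.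
  rewrite -prod_phi; apply: eq_bigr => a _; rewrite gE edet_log; [|exact: (thP a).1|exact: (thP a).2].
  rewrite /tlog [X in half *: X]annM ?scaler0 ?subr0 //.
    by rewrite scalemxAl -yE scalemxAl g0 mul0mx.
  by rewrite scalemxAl -yE scalemxAl g0 mul0mx.
have om2J : {in C & Group gL, forall s k, om1 s * om2 k = om2 (k ^ s^-1)%g * om1 s}.
  move=> s k; rewrite CE inE => /eqP sA /eqP k0; rewrite mulrC; congr (_ * _).
  rewrite /om2 GL_J GL_VxE; congr phi.
  have [y yE] := annE _ k0.
  have -> : invmx (invmx (GLval s)) *m GLval k *m invmx (GLval s) - 1%:M =
      e *: (GLval s *m y *m invmx (GLval s)).
    rewrite invmxK scalemxAl scalemxAr -yE.
    by rewrite mulmxBr mulmxBl mulmx1 GL_mulmxV.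
  have -> : T *m (e *: (GLval s *m y *m invmx (GLval s))) =
      GLval s *m (T *m (e *: y)) *m invmx (GLval s).
    rewrite -scalemxAr !mulmxA 2!scalemxAl TC // -scalemxAl; congr (_ *m _).
    exact: scalemxAr.
  by rewrite yE [RHS]mxtrace_mulC !mulmxA GL_mulVmx mul1mx.
have [Om [OmM OmC OmL]] := glue_morphisms nL om1_1 om1M om2M om12 om2J.
have split_cent (g : gT) (c : Mat) : c *m A = A *m c -> e *: c = e *: GLval g ->
    exists2 k, k \in Group gL & exists2 c', c' \in C & GLval c' = c /\ g = (c' * k)%g.
  move=> cA cg; have uc : c \in unitmx.
    have uVc : 1%:M + (invmx (GLval g) *m c - 1%:M) \in unitmx.
      apply: unitmx_add1_nil; rewrite [X in X *m _]annM ?mul0mx //.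
      1,2: by rewrite -(GL_mulVmx g) -mulmxBr scalemxAr scalerBr cg subrr mulmx0.
    rewrite addrCA subrr addr0 in uVc.
    by rewrite -[c](mulKVmx (GL_unitmx g)) unitmx_mul uVc GL_unitmx.
  have [c' c'E] := GL_of_unitmx uc; exists (c'^-1 * g)%g.
    rewrite inE GL_MxE GL_VxE -(GL_mulVmx c') -mulmxBr scalemxAr scalerBr -cg c'E.
    by rewrite subrr mulmx0.
  by exists c'; rewrite ?mulKVg // CE c'E cA.
have inCL g : g \in mod_cent e T -> g \in (C <*> Group gL)%g.
  rewrite mod_cent_jordan inE => /eqP gA.
  have [c cA cg] := lift_centralizer (esym gA).
  have [k Lk [c' Cc' [_ ->]]] := split_cent g c cA cg.
  by rewrite norm_joinEl // mem_mulg.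
exists Om; split=> [g k /inCL gCL /inCL kCL|g]; first exact: OmM.
rewrite mod_cent_jordan inE => /andP[Sg Kg].
have /congr_subP[x gx] := Kg.
(* As [g - 1 = e x], commutation of [g] after one factor [e] constrains [x] after two; [x] is
   therefore lifted to the exact centralizer modulo the annihilator of [e ^+ 2]. *)
have xA : e ^+ 2 *: (x *m A) = e ^+ 2 *: (A *m x).
  move: Sg; rewrite inE gx mulmxDl mulmxDr mul1mx mulmx1 !scalerDr (inj_eq (addrI _)).
  by rewrite -scalemxAl -scalemxAr !scalerA -expr2 => /eqP->.
have [y yA yx] := lift_centralizer xA.
have [||k Lk [c Cc [cE gE]]] := split_cent g (1%:M + e *: y).
- by rewrite mulmxDl mulmxDr mul1mx mulmx1 -scalemxAl -scalemxAr yA.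
- by rewrite gx !scalerDr !scalerA -expr2 yx.
have k0 : e *: (GLval k - 1%:M) = 0 by move: Lk; rewrite inE => /eqP.
have Kc : c \in congruence_subgroup N e by apply/congr_subP; exists y.
have Kk : k \in congruence_subgroup N e.
  by have [z zE] := annE _ k0; apply/congr_subP; exists z; rewrite -zE addrCA subrr addr0.
have Sk : k \in mod_cent e T.
  have ek : e *: GLval k = e *: 1%:M by apply/eqP; rewrite -subr_eq0 -scalerBr k0.
  by rewrite inE scalemxAr scalemxAl ek -scalemxAl -scalemxAr mul1mx mulmx1.
have JC : c \in (C <*> Group gL)%g by rewrite (subsetP (joing_subl _ _)).
have JL : k \in (C <*> Group gL)%g by rewrite (subsetP (joing_subr _ _)).
rewrite gE OmM // OmC // OmL // (glog_charM T e3 half2 phiD Kc Kk).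
have RMk : k \in ([group of mod_cent e T] :&: [group of congruence_subgroup N e])%G.
  by rewrite inE Sk.
rewrite (pairingC half T phi0 phiD Kk Kc) (pairing_rad half e3 phi0 RMk Kc) invr1 mulr1.
congr (_ * _); last first.
  by rewrite /om2 /glog_char /glog /tlog [X in half *: X]annM ?scaler0 ?subr0.
(* [e *: Z] is the logarithm of [1 + e y]; it commutes with [A], so its trace against [T] splits
   over eigenvalues. *)
pose Z := y - (half * e) *: (y *m y).
have tlogE v : tlog half (e *: v) = e *: (v - (half * e) *: (v *m v)).
  rewrite /tlog -scalemxAl -scalemxAr scalerBr !scalerA; congr (_ - _ *: _); ring.
have ZA : e *: (Z *m A) = e *: (A *m Z).
  rewrite /Z mulmxBl mulmxBr yA -scalemxAl -scalemxAr; congr (_ *: (_ - _ *: _)).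
  by rewrite -mulmxA yA !mulmxA yA.
rewrite /glog_char /glog cE addrAC subrr add0r tlogE -/Z -(eigen_trace ZA) -prod_phi.
apply: eq_bigr => a _; rewrite cE edet_log; [|exact: (thP a).1|exact: (thP a).2].
congr (phi (_ * \tr _)); rewrite tlogE; congr (_ *: _); rewrite /Z mulmxBl -scalemxAl.
congr (_ - _ *: _); have Ey : eE a *m y = y *m eE a := comm_eigen_proj hD unitD a yA.
by rewrite -mulmxA (mulmxA (eE a)) Ey -mulmxA eE_idem mulmxA.
Qed.

End JordanCharacter.

(** * Truncations of the ring of integers *)

Section Truncations.

Variables (R : comNzRingType) (a : R) (Q : quotients a).
Hypothesis a_reg : forall x y, a * x = a * y -> x = y.

Lemma red_lift s (y : trunc Q s) : red Q s (Defs.lift y) = y.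
Proof. exact/eqP/(xchooseP (red_onto y)). Qed.

Lemma map_red_lift s m n (Y : 'M[trunc Q s]_(m, n)) :
  map_mx (red Q s) (map_mx (@Defs.lift _ _ Q s) Y) = Y.
Proof. by apply/matrixP=> i j; rewrite !mxE red_lift. Qed.

Lemma aX_reg m x y : a ^+ m * x = a ^+ m * y -> x = y.
Proof.
elim: m x y => [|m IHm] x y; first by rewrite !mul1r.
by rewrite exprS -!mulrA => /a_reg/IHm.
Qed.

Lemma res_a : res Q a = 0. Proof. by apply/res_ker; exists 1; rewrite mulr1. Qed.

Lemma red_aX0 s m : (0 < s <= m)%N -> red Q s a ^+ m = 0.
Proof.
case/andP=> s0 sm; rewrite -rmorphXn; apply/red_ker => //.
by exists (a ^+ (m - s)); rewrite -exprD subnKC.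
Qed.

Lemma red_scale0 s m x : (0 < s)%N ->
  (red Q (s + m) a ^+ m * red Q (s + m) x == 0) = (red Q s x == 0).
Proof.
move=> s0; rewrite -rmorphXn -rmorphM; apply/eqP/eqP.
  case/red_ker=> [|y]; first by rewrite addn_gt0 s0.
  by rewrite addnC exprD -mulrA => /aX_reg ->; apply/red_ker => //; exists y.
case/red_ker=> // y ->; apply/red_ker; first by rewrite addn_gt0 s0.
by exists y; rewrite mulrA -exprD addnC.
Qed.

Lemma red_scale_mx0 s m n1 n2 (X : 'M[R]_(n1, n2)) : (0 < s)%N ->
  red Q (s + m) a ^+ m *: map_mx (red Q (s + m)) X = 0 <-> map_mx (red Q s) X = 0.
Proof.
move=> s0; split=> /matrixP E; apply/matrixP=> i j; have := E i j; rewrite !mxE => /eqP.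
  by rewrite red_scale0 // => /eqP.
by rewrite -(red_scale0 m) // => /eqP.
Qed.

Lemma res_scale0 s x : red Q s.+1 a ^+ s * red Q s.+1 x = 0 -> res Q x = 0.
Proof.
rewrite -rmorphXn -rmorphM => /red_ker[//|y].
by rewrite exprSr -mulrA => /aX_reg ->; rewrite rmorphM res_a mul0r.
Qed.

Lemma res_red_lift s x : (0 < s)%N -> res Q (Defs.lift (red Q s x)) = res Q x.
Proof.
move=> s0; have /eqP := red_lift (red Q s x); rewrite -subr_eq0 -rmorphB => /eqP.
case/red_ker=> // y /(congr1 (res Q)); rewrite rmorphB rmorphM rmorphXn res_a.
by rewrite expr0n eqn0Ngt s0 mul0r => /eqP; rewrite subr_eq0 => /eqP.
Qed.

(** A lift of the residue inverse is an inverse up to [1 + a z], which a finite geometric series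
    inverts since [a] is nilpotent in the quotient. *)
Lemma red_unit s x : (0 < s)%N -> res Q x != 0 -> red Q s x \is a GRing.unit.
Proof.
move=> s0 x0; have [y /eqP yE] := res_onto (q := Q) (res Q x)^-1.
have : res Q (x * y - 1) = 0 by rewrite rmorphB rmorphM rmorph1 /= yE divff ?subrr.
case/res_ker=> z /(canRL (subrK _)) xy.
apply/unitrPr; exists (red Q s y * \sum_(i < s) (- (red Q s (a * z))) ^+ i).
rewrite mulrA -rmorphM xy rmorphD rmorph1; set u := red Q s (a * z).
have : u ^+ s = 0 by rewrite /u rmorphM exprMn red_aX0 ?s0 ?leqnn // mul0r.
have := subrX1 (- u) s; rewrite [(- u) ^+ s]exprNn => /[swap] ->.
by rewrite mulr0 sub0r => /eqP; rewrite -opprD mulNr eqr_opp => /eqP.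
Qed.

Lemma unit_red s x : (0 < s)%N -> red Q s x \is a GRing.unit -> res Q x != 0.
Proof.
move=> s0 /unitrPr[y]; rewrite -[y]red_lift -rmorphM -(rmorph1 (red Q s)) => /eqP.
rewrite -subr_eq0 -rmorphB => /eqP/red_ker[//|z /(congr1 (res Q))].
rewrite rmorphB !rmorphM rmorphXn res_a expr0n eqn0Ngt s0 mul0r rmorph1 => /eqP.
by apply: contraTneq => ->; rewrite mul0r sub0r oppr_eq0 oner_neq0.
Qed.

Lemma unitmx_red s t n (X : 'M[R]_n) : (0 < s)%N -> (0 < t)%N ->
  map_mx (red Q s) X \in unitmx -> map_mx (red Q t) X \in unitmx.
Proof.
by move=> s0 t0; rewrite !unitmxE !det_map_mx => /(unit_red s0); apply: red_unit.
Qed.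

End Truncations.

(** * Integers of a local field and additive characters of their truncations *)

Section Uniformizer.

Variables (F : localField) (pi : integers F).
Hypothesis hpi : uniformizer pi.
Local Notation O := (integers F).

Lemma int_val_inj : injective (@int_val F). Proof. exact: val_inj. Qed.

Lemma int_valM (x y : O) : int_val (x * y) = int_val x * int_val y. Proof. by []. Qed.
Lemma int_valD (x y : O) : int_val (x + y) = int_val x + int_val y. Proof. by []. Qed.
Lemma int_valB (x y : O) : int_val (x - y) = int_val x - int_val y. Proof. by []. Qed.
Lemma int_val0 : int_val (0 : O) = 0. Proof. by []. Qed.
Lemma int_valX (x : O) n : int_val (x ^+ n) = int_val x ^+ n.
Proof. by elim: n => [|n IHn] //; rewrite !exprS int_valM IHn. Qed.

Lemma pi_neq0 : int_val pi != 0.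
Proof.
have [x x0 vx] := val_onto (lf_valP F).
have xO : x \in @integral F by rewrite /integral /in_mem /= /val_ge vx orbT.
have /(hpi (Integers xO))[y xy] : val_ge (@lf_val F) 1 x.
  by rewrite /val_ge vx lexx orbT.
have := congr1 (@int_val F) xy; rewrite int_valM /= => E.
by apply: contraNneq x0 => p0; rewrite E p0 mul0r.
Qed.

Lemma pi_reg (x y : O) : pi * x = pi * y -> x = y.
Proof.
move/(congr1 (@int_val F)); rewrite !int_valM => /(mulfI pi_neq0) E.
exact: int_val_inj.
Qed.

Lemma integer_inv (x : O) : (forall y, x <> pi * y) -> exists y, x * y = 1.
Proof.
move=> xpi; have nv1 : ~~ val_ge (@lf_val F) 1 (int_val x).
  by apply/negP=> /(hpi x)[y]; apply: xpi.
move: nv1; rewrite /val_ge negb_or -ltNge => /andP[x0 vx1].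
have vx : lf_val (int_val x) = 0.
  apply/eqP; rewrite eq_le -ltzD1 add0r vx1 /=.
  by have := int_valP x; rewrite /integral /in_mem /= /val_ge (negPf x0).
have x'O : (int_val x)^-1 \in @integral F.
  rewrite /integral /in_mem /= /val_ge invr_eq0 (negPf x0) /=.
  have := Defs.valM (lf_valP F) x0 (_ : (int_val x)^-1 != 0).
  by rewrite invr_eq0 divff // lf_val1 vx add0r => ->.
by exists (Integers x'O); apply: int_val_inj; rewrite int_valM /= divff.
Qed.

Lemma integer_factor r (x : O) : (forall y, x <> pi ^+ r * y) ->
  exists i u v, [/\ (i < r)%N, x = pi ^+ i * u & u * v = 1].
Proof.
elim: r x => [|r IHr] x xr; first by case: (xr x); rewrite mul1r.
have [/(hpi x)[y xy]|nx] := boolP (val_ge (@lf_val F) 1 (int_val x)).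
  have [z yz|i [u [v [ir yE uv]]]] := IHr y.
    by apply: (xr z); rewrite xy yz exprS mulrA.
  by exists i.+1, u, v; rewrite xy yE exprS mulrA.
have [y xy|v xv] := @integer_inv x.
  by case/negP: nx; apply/hpi; exists y.
by exists 0%N, x, v; rewrite mul1r.
Qed.

Variables (Q : quotients pi) (psi : F -> algC).
Hypothesis hpsi : level_zero_character pi psi.

Definition trunc_char r (y : trunc Q r) : algC :=
  psi (int_val pi ^- r * int_val (Defs.lift y)).

Let psiD x y : psi (x + y) = psi x * psi y. Proof. by case: hpsi. Qed.
Let psiO (x : O) : psi (int_val x) = 1. Proof. by case: hpsi. Qed.

Lemma trunc_charE r (x : O) : (0 < r)%N ->
  trunc_char (red Q r x) = psi (int_val pi ^- r * int_val x).
Proof.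
move=> r0; have /eqP := red_lift (red Q r x); rewrite -subr_eq0 -rmorphB => /eqP.
case/red_ker=> // y /(canRL (subrK _)) E; rewrite /trunc_char E int_valD mulrDr psiD.
by rewrite int_valM int_valX mulKf ?psiO ?mul1r // expf_neq0 // pi_neq0.
Qed.

Lemma trunc_charD r (x y : trunc Q r) : (0 < r)%N ->
  trunc_char (x + y) = trunc_char x * trunc_char y.
Proof.
move=> r0; rewrite -[x]red_lift -[y]red_lift -rmorphD !trunc_charE // -psiD.
by rewrite int_valD mulrDr.
Qed.

Lemma trunc_char0 r : (0 < r)%N -> trunc_char (0 : trunc Q r) = 1.
Proof.
by move=> r0; rewrite -(rmorph0 (red Q r)) trunc_charE // int_val0 mulr0 (psiO 0).
Qed.

Lemma trunc_char_prim r (y : trunc Q r) : (0 < r)%N ->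
  (forall z, trunc_char (y * z) = 1) -> y = 0.
Proof.
move=> r0 y1; apply/eqP; apply/negPn/negP => y0.
have [z yz|i [u [v [ir yE uv]]]] := @integer_factor r (Defs.lift y).
  by case/eqP: y0; rewrite -[y]red_lift; apply/red_ker => //; exists z.
have [_ _ [x /eqP[]]] := hpsi.
(* Writing [y = pi^i u] with [i < r], this multiplier turns [y] into [pi^(r-1) x], where [psi] takes
   the nontrivial value at [pi^-1 x]. *)
have := y1 (red Q r (v * pi ^+ (r - i.+1) * x)); rewrite -{1}[y]red_lift -rmorphM yE.
rewrite trunc_charE // => <-; congr psi.
have -> : pi ^+ i * u * (v * pi ^+ (r - i.+1) * x) = pi ^+ r.-1 * x.
  transitivity ((u * v) * (pi ^+ i * pi ^+ (r - i.+1)) * x); first by ring.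
  by rewrite uv mul1r -exprD; congr (_ ^+ _ * _); lia.
rewrite int_valM int_valX; case: (r) r0 => // m _ /=.
by rewrite exprS invfM -mulrA mulKf // expf_neq0 // pi_neq0.
Qed.

Lemma trunc_char_unity_root r (y : trunc Q r) : (0 < r)%N ->
  exists2 m, (0 < m)%N & trunc_char y ^+ m = 1.
Proof.
move=> r0; have [m m0 ym] : exists2 m, (0 < m)%N & y *+ m = 0.
  by exists #[y]%g; rewrite ?order_gt0 // -FinRing.zmodXgE expg_order.
exists m => //; suff P k : trunc_char y ^+ k = trunc_char (y *+ k) by rewrite P ym trunc_char0.
by elim: k => [|k IHk]; rewrite ?mulr0n ?trunc_char0 // exprS mulrS trunc_charD // IHk.
Qed.

Lemma trunc_char_conj r (y : trunc Q r) : (0 < r)%N ->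
  (trunc_char y)^* = (trunc_char y)^-1.
Proof.
move=> r0; have [m m0 ym] := trunc_char_unity_root y r0.
have n1 : `|trunc_char y| = 1.
  by apply/eqP; rewrite -(pexpr_eq1 m0) // -normrX ym normr1.
by rewrite invC_norm n1 expr1n invr1 mul1r.
Qed.

Lemma integer_half p : p \in [pchar resfield Q] -> (2 < p)%N ->
  exists half : O, half + half = 1.
Proof.
move=> pk p2; have [y|z z1] := @integer_inv 2%:R.
  move/(congr1 (res Q)); rewrite rmorphM (res_a Q) mul0r rmorph_nat => /eqP.
  by rewrite -(dvdn_pcharf pk) => p_2; by have := dvdn_leq (isT : (0 < 2)%N) p_2; rewrite leqNgt p2.
by exists z; rewrite -mulr2n -mulr_natl.
Qed.

End Uniformizer.

(** * Unramified base change of truncated rings *)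

Section Unramified.

Variables (F : localField) (pi : integers F) (hpi : uniformizer pi).
Variable E : unramified_extension F.

Fact ue_embed_is_zmod_morphism : zmod_morphism (ue_embed E).
Proof.
move=> x y; apply: (@int_val_inj (ue_localField E)).
by rewrite int_valB /= scalerBl.
Qed.

Fact ue_embed_is_monoid_morphism : monoid_morphism (ue_embed E).
Proof.
split=> [|x y]; apply: (@int_val_inj (ue_localField E)).
  by rewrite /= scale1r.
by rewrite int_valM /= -scalerAl mul1r scalerA.
Qed.

HB.instance Definition _ :=
  GRing.isZmodMorphism.Build _ _ (ue_embed E) ue_embed_is_zmod_morphism.
HB.instance Definition _ :=
  GRing.isMonoidMorphism.Build _ _ (ue_embed E) ue_embed_is_monoid_morphism.

Lemma ue_pi_reg (x y : integers (ue_localField E)) :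
  ue_embed E pi * x = ue_embed E pi * y -> x = y.
Proof.
move/(congr1 (@int_val (ue_localField E))); rewrite !int_valM /= => Exy.
apply: int_val_inj; apply: (mulfI _ Exy).
by rewrite scaler_eq0 oner_eq0 orbF (pi_neq0 hpi).
Qed.

(** The valuation restricts to that of [F] without ramification, so a quotient integral upstairs is
    already integral in [F]. *)
Lemma ue_dvd r (x : integers F) y : ue_embed E x = ue_embed E pi ^+ r * y ->
  exists z, x = pi ^+ r * z.
Proof.
move=> xy; have := congr1 (@int_val (ue_localField E)) xy.
rewrite -rmorphXn int_valM /= => xyE.
have [x0|x0] := eqVneq (int_val x) 0.
  by exists 0; rewrite mulr0; apply: int_val_inj.
have p0 : int_val (pi ^+ r) != 0 by rewrite int_valX expf_neq0 // pi_neq0.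
have xpO : int_val x / int_val (pi ^+ r) \in @integral F.
  have xp0 : int_val x / int_val (pi ^+ r) != 0 by rewrite mulf_neq0 ?invr_eq0.
  rewrite /integral /in_mem /= /val_ge (negPf xp0) /=.
  rewrite -(ue_unramified E) //.
  have -> : (int_val x / int_val (pi ^+ r))%:A = int_val y :> ue_field E.
    have p0' : (int_val (pi ^+ r))%:A != 0 :> ue_field E by rewrite scaler_eq0 oner_eq0 orbF.
    by apply: (mulfI p0'); rewrite -xyE -scalerAl mul1r scalerA mulrC divfK.
  have := int_valP y; rewrite /integral /in_mem /= /val_ge.
  by case: eqP => // y0; move: xyE; rewrite y0 mulr0 => /eqP; rewrite scaler_eq0 oner_eq0 orbF (negPf x0).
exists (Integers xpO); apply: int_val_inj; rewrite int_valM /=.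
by rewrite mulrC divfK.
Qed.

Variables (Q : quotients pi) (Qh : quotients (ue_embed E pi)).

Lemma trunc_embedding r : (0 < r)%N ->
  exists iota : {rmorphism trunc Q r -> trunc Qh r},
    injective iota /\ forall x, iota (red Q r x) = red Qh r (ue_embed E x).
Proof.
move=> r0; pose f (y : trunc Q r) := red Qh r (ue_embed E (Defs.lift y)).
have fE x : f (red Q r x) = red Qh r (ue_embed E x).
  have /eqP := red_lift (red Q r x); rewrite -subr_eq0 -rmorphB => /eqP.
  case/red_ker=> // z /(congr1 (fun u => red Qh r (ue_embed E u))).
  rewrite rmorphM rmorphXn rmorphM rmorphXn red_aX0 ?r0 ?leqnn // mul0r.
  by rewrite !rmorphB => /eqP; rewrite subr_eq0 => /eqP.
have fB : zmod_morphism f.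
  by move=> x y; rewrite -[x]red_lift -[y]red_lift -rmorphB !fE !rmorphB.
have fM : monoid_morphism f.
  split=> [|x y]; first by rewrite -(rmorph1 (red Q r)) fE !rmorph1.
  by rewrite -[x]red_lift -[y]red_lift -rmorphM !fE !rmorphM.
pose fB' := GRing.isZmodMorphism.Build _ _ f fB.
pose fM' := GRing.isMonoidMorphism.Build _ _ f fM.
pose io : {rmorphism trunc Q r -> trunc Qh r} := HB.pack f fB' fM'.
exists io; split=> [|x]; last exact: fE.
apply: raddf_inj => y; rewrite -[y]red_lift => fy; have {fy} : f (red Q r (Defs.lift y)) = 0 by [].
rewrite fE => /red_ker[//|z /ue_dvd[u ->]].
by rewrite rmorphM rmorphXn red_aX0 ?r0 ?leqnn // mul0r.
Qed.

End Unramified.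

Lemma extend_additive_char (R S : finComUnitRingType) (f : {rmorphism R -> S})
    (phi : R -> algC) :
    injective f -> phi 0 = 1 -> (forall x y, phi (x + y) = phi x * phi y) ->
  exists phih : S -> algC,
    [/\ phih 0 = 1, forall x y, phih (x + y) = phih x * phih y
      & forall x, phih (f x) = phi x].
Proof.
move=> f_inj phi0 phiD.
pose H := [set f x | x in [set: R]].
have gH : group_set H.
  apply/group_setP; split=> [|_ _ /imsetP[x _ ->] /imsetP[y _ ->]].
    by apply/imsetP; exists 0; rewrite ?inE ?rmorph0.
  by apply/imsetP; exists (x + y); rewrite ?inE ?rmorphD.
pose g (y : S) := if [pick x | f x == y] is Some x then phi x else 0.
have gE x : g (f x) = phi x.
  by rewrite /g; case: pickP => [x' /eqP/f_inj->|/(_ x)] //; rewrite eqxx.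
have g1 : g 1%g = 1 by rewrite FinRing.zmod1gE -(rmorph0 f) gE.
have gM : {in Group gH &, {morph g : x y / (x * y)%g >-> x * y}}.
  move=> _ _ /imsetP[x _ ->] /imsetP[y _ ->].
  by rewrite FinRing.zmodMgE -rmorphD !gE phiD.
have cS : abelian [set: S] by exact: FinRing.zmod_abelian.
have [h [hM hH]] := extend_abelian_char cS (subsetT (Group gH)) g1 gM.
have hf x : h (f x) = phi x by rewrite hH ?gE //; apply/imsetP; exists x.
exists h; split=> //; first by rewrite -(rmorph0 f) hf.
by move=> x y; rewrite -hM ?inE.
Qed.

(** The label is the block number. Inside one block, positions differ from global indices by a
    common offset, so the superdiagonal condition can be read globally. *)
Lemma jordan_form_labels (R : nzRingType) n (A : 'M[R]_n) : jordan_form A ->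
  exists h : 'I_n -> nat,
    [/\ forall i j : 'I_n, (i <= j)%N -> (h i <= h j)%N,
        forall i j, h i = h j -> A i i = A j j
      & forall i j, A i j = A i i *+ (i == j) + ((i.+1 == j :> nat) && (h i == h j))%:R].
Proof.
case=> m [d [lam [e ->]]]; case: n / e {A}; rewrite castmx_id.
set J := \mxdiag_i _; pose h (i : 'I_(\sum_i d i)) := tagnat.sig1 i : nat.
have JE i j : J i j = if h i == h j
    then lam (tagnat.sig1 i) *+ (i == j) + (i.+1 == j :> nat)%:R else 0.
  have jordE k k' (x : 'I_(d k)) (y : 'I_(d k')) :
      (if k == k' then conform_mx 0 (jordan_block (d k) (lam k)) else 0) x y =
      if k == k' then lam k *+ (x == y :> nat) + (x.+1 == y :> nat)%:R else 0.
    case: eqVneq x y => [<-|_] x y; last by rewrite mxE.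
    by rewrite conform_mx_id mxE.
  rewrite mxE jordE (inj_eq (@ord_inj _)); case: eqVneq => // hij.
  have ij : (i + tagnat.sig2 j = j + tagnat.sig2 i)%N.
    have := tagnat.rect i; have := tagnat.rect j.
    by rewrite -[in X in _ = X -> _](congr1 (@nat_of_ord m) hij) => -> ->; rewrite addnAC.
  have -> : (tagnat.sig2 i == tagnat.sig2 j :> nat) = (i == j).
    by apply/eqP/eqP => [E|->] //; apply: ord_inj; lia.
  by congr (_ + _%:R); congr nat_of_bool; apply/eqP/eqP; lia.
have JD i : J i i = lam (tagnat.sig1 i).
  by rewrite JE !eqxx gtn_eqF // addr0.
exists h; split=> [i j ij|i j hij|i j].
- exact: tagnat.le_sig1.
- by rewrite !JD; congr lam; apply: ord_inj.
- rewrite JD JE; case: (eqVneq (h i) (h j)) => [_|hij]; rewrite ?andbT //.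
  by rewrite andbF addr0; case: (i =P j) hij => [->|//]; rewrite eqxx.
Qed.

(** * The annihilator of [pi^l'] in the truncated ring *)

Section Annihilator.

Variables (R : comNzRingType) (a : R) (Q : quotients a).
Hypothesis a_reg : forall x y, a * x = a * y -> x = y.
Variables (l l' : nat).
Hypothesis ll' : (l' <= l)%N.
Hypothesis l0 : (0 < l)%N.

Local Notation r := (l + l')%N.
Local Notation w := (red Q r a).
Local Notation e := (w ^+ l').

Lemma red_scale_mx_eq n1 n2 (X Y : 'M[R]_(n1, n2)) :
  e *: map_mx (red Q r) X = e *: map_mx (red Q r) Y <->
  map_mx (red Q l) X = map_mx (red Q l) Y.
Proof.
have [H1 H2] := red_scale_mx0 Q a_reg l' (X - Y) l0.
split=> /eqP; rewrite -subr_eq0.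
  by rewrite -scalerBr -map_mxB => /eqP/H1/eqP; rewrite map_mxB subr_eq0 => /eqP.
by rewrite -map_mxB => /eqP/H2/eqP; rewrite map_mxB scalerBr subr_eq0 => /eqP.
Qed.

Lemma annihilator_e y : e * y = 0 -> exists z, y = w ^+ l * z.
Proof.
rewrite -[y]red_lift => /eqP; rewrite red_scale0 // => /eqP/red_ker[//|z ->].
by exists (red Q r z); rewrite rmorphM rmorphXn.
Qed.

Lemma annihilator_e_sqr y z : e * y = 0 -> e * z = 0 -> y * z = 0.
Proof.
move=> /annihilator_e[y' ->] /annihilator_e[z' ->].
by rewrite mulrACA -exprD red_aX0 ?mul0r //; apply/andP; split; lia.
Qed.

Lemma annihilator_e_sub y : e * y = 0 -> exists z, y = e * z.
Proof.
move=> /annihilator_e[y' ->]; exists (w ^+ (l - l') * y').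
by rewrite mulrA -exprD subnKC.
Qed.

End Annihilator.

Lemma map_tlog (S T : comNzRingType) (f : {rmorphism S -> T}) n (c : S) (u : 'M[S]_n) :
  map_mx f (tlog c u) = tlog (f c) (map_mx f u).
Proof. by rewrite /tlog map_mxB map_mxZ map_mxM. Qed.

(** * Descent of the linear character from the unramified extension *)

Section StableChar.

Variables (F : localField) (pi : integers F) (hpi : uniformizer pi).
Variables (Q : quotients pi) (N l' : nat).
Hypothesis l'0 : (0 < l')%N.
Local Notation l := l'.+1.
Local Notation r := (l + l')%N.
Local Notation R := (trunc Q r).
Local Notation e := (red Q r pi ^+ l').

Variables (half : R) (phi : R -> algC).
Hypothesis half2 : half + half = 1.
Hypotheses (phi0 : phi 0 = 1) (phiD : forall x y, phi (x + y) = phi x * phi y).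
Variable Mhat : 'M[trunc Q l]_N.-1.+1.
Hypothesis stableM : Defs.stable Mhat.

(** An arbitrary lift of [Mhat] from [O_l] to [O_r]; two lifts agree after multiplication by [e]. *)
Definition stable_lift : 'M[R]_N.-1.+1 :=
  map_mx (red Q r) (map_mx (@Defs.lift _ _ Q l) Mhat).
Local Notation M := stable_lift.

(** [GL_N(O_r)] is embedded over the extension and conjugated to Jordan form, and the character
    found there is pulled back. For this [phi] is first extended along the injection of truncated
    rings. *)
Theorem stable_linear_char : exists om : {'GL_N[R]} -> algC,
  {in mod_cent e M &, {morph om : x y / (x * y)%g >-> x * y}} /\
  {in mod_cent e M :&: congruence_subgroup N e, om =1 glog_char half phi M}.
Proof.
case: stableM => E [Qh [mu [[muM resmu] [g [A [B [ug gM jA Amu BZ]]]]]]].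
have r0 : (0 < r)%N by [].
have [io [io_inj ioE]] := trunc_embedding hpi Q Qh r0.
have [phih [phih0 phihD phihE]] := extend_additive_char io_inj phi0 phiD.
have [h [h_mono hA AE]] := jordan_form_labels jA.
have areg := ue_pi_reg hpi (E := E).
pose w : trunc Qh r := red Qh r (ue_embed E pi); pose eh := w ^+ l'.
have ioe : io e = eh by rewrite rmorphXn ioE.
(* Lifting the diagonal through [mu] makes distinct eigenvalues differ by units: if two residues
   agree, so do their images under [mu]. *)
pose At := \matrix_(i, j) (mu (res_red (A i i)) *+ (i == j)
   + ((i.+1 == j :> nat) && (h i == h j))%:R).
pose Bt := map_mx (@Defs.lift _ _ Qh l) B.
pose gt := map_mx (@Defs.lift _ _ Qh l) g.
pose Mt := map_mx (ue_embed E) (map_mx (@Defs.lift _ _ Q l) Mhat).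
have redB : map_mx (red Qh l) Bt = B by apply: map_red_lift.
have redg : map_mx (red Qh l) gt = g by apply: map_red_lift.
have redA : map_mx (red Qh l) At = A.
  apply/matrixP=> i j; rewrite !mxE [RHS]AE rmorphD rmorphMn rmorph_nat.
  by congr (_ *+ _ + _); rewrite [in RHS]Amu mxE.
pose D i := red Qh r (mu (res_red (A i i))).
have bidiagE : map_mx (red Qh r) At = bidiag D h.
  by apply/matrixP=> i j; rewrite !mxE rmorphD rmorphMn rmorph_nat.
pose Br := map_mx (red Qh r) Bt; pose gr := map_mx (red Qh r) gt.
pose T := bidiag D h + w *: Br.
have scaleE X Y := red_scale_mx_eq Qh areg l' (ltn0Sn l') X Y.
have hD i j : h i = h j -> D i = D j by move=> hij; rewrite /D (hA i j).
have unitD i j : D i != D j -> D i - D j \is a GRing.unit.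
  move=> Dij; rewrite /D -rmorphB red_unit // rmorphB !resmu subr_eq0.
  by apply: contraNneq Dij => aij; rewrite /D aij.
have eh3 : eh ^+ 3 = 0 by rewrite -exprM red_aX0 //; apply/andP; split; lia.
have halfh : io half + io half = 1 by rewrite -rmorphD half2 rmorph1.
have wnil : exists m, w ^+ m = 0.
  by exists r; rewrite red_aX0 ?leqnn.
have BA : eh *: (Br *m bidiag D h) = eh *: (bidiag D h *m Br).
  rewrite -bidiagE -!map_mxM; apply/scaleE; rewrite !map_mxM redA redB.
  by have [] := BZ.
have BC (X : 'M_N.-1.+1) : eh *: (X *m bidiag D h) = eh *: (bidiag D h *m X) ->
    eh *: (Br *m X) = eh *: (X *m Br).
  rewrite -bidiagE -[X]map_red_lift -!map_mxM => /scaleE XA.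
  apply/scaleE; rewrite !map_mxM redB; have [_] := BZ; apply.
  by move: XA; rewrite !map_mxM redA.
have [Om [OmM OmE]] := jordan_linear_char h_mono hD unitD eh3 halfh
  (annihilator_e_sqr areg (leqnSn l') (ltn0Sn l'))
  (annihilator_e_sub areg (leqnSn l') (ltn0Sn l')) wnil phih0 phihD BA BC.
have ur : gr \in unitmx by apply: unitmx_red (ltn0Sn l') r0 _; rewrite redg.
have ioM : map_mx io M = map_mx (red Qh r) Mt.
  by apply/matrixP=> i j; rewrite !mxE ioE.
(* Modulo [pi^l] this is the given conjugation to [A + pi B]; over [O_r] it survives only after the
   factor [e]. *)
have gT : eh *: (gr *m map_mx io M) = eh *: (T *m gr).
  have -> : T *m gr = map_mx (red Qh r) ((At + ue_embed E pi *: Bt) *m gt).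
    by rewrite map_mxM map_mxD map_mxZ bidiagE.
  rewrite ioM -map_mxM; apply/scaleE; rewrite !map_mxM map_mxD map_mxZ redA redB redg.
  rewrite -gM mulmxKV //; congr (_ *m _).
  by apply/matrixP=> i j; rewrite !mxE.
have conj_ex (s : {'GL_N[R]}) : exists t : {'GL_N[trunc Qh r]},
    GLval t = gr *m map_mx io (GLval s) *m invmx gr.
  apply: GL_of_unitmx; rewrite !unitmx_mul ur unitmx_inv ur andbT /=.
  by rewrite unitmxE det_map_mx rmorph_unit // -unitmxE GL_unitmx.
have /fin_all_exists[G GE] := conj_ex.
have GM s t : G (s * t)%g = (G s * G t)%g.
  apply: val_inj; rewrite -[LHS]/(GLval _) -[RHS]/(GLval _) GL_MxE !GE GL_MxE map_mxM.
  by rewrite !mulmxA mulmxKV.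
have gTV : eh *: (map_mx io M *m invmx gr) = eh *: (invmx gr *m T).
  have := congr1 (fun X => invmx gr *m X *m invmx gr) gT.
  by rewrite /= -!(scalemxAr, scalemxAl) !mulmxA mulVmx // mul1mx mulmxK.
have GS s : s \in mod_cent e M -> G s \in mod_cent eh T.
  rewrite !inE GE => /eqP sM; apply/eqP.
  have ioS : eh *: (map_mx io M *m map_mx io (GLval s)) =
             eh *: (map_mx io (GLval s) *m map_mx io M).
    by rewrite -!map_mxM -ioe -!map_mxZ sM.
  transitivity (eh *: (gr *m (map_mx io (GLval s) *m map_mx io M) *m invmx gr)).
    rewrite !mulmxA 2!scalemxAl -gT -2!scalemxAl -(mulmxA gr) scalemxAl scalemxAr ioS.
    by rewrite -scalemxAr -scalemxAl !mulmxA.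
  by rewrite !mulmxA -(mulmxA _ _ (invmx gr)) scalemxAr gTV -scalemxAr mulmxA.
have GK s : s \in congruence_subgroup N e -> G s \in congruence_subgroup N eh.
  case/congr_subP=> x sx; apply/congr_subP; exists (gr *m map_mx io x *m invmx gr).
  rewrite GE sx map_mxD map_mx1 map_mxZ ioe mulmxDr mulmxDl mulmx1 mulmxV //.
  by rewrite -scalemxAr -scalemxAl.
exists (fun s => Om (G s)); split=> [s t Ss St|s].
  by rewrite GM OmM // GS.
rewrite inE => /andP[Ss Ks]; rewrite OmE; last by rewrite inE GS // GK.
rewrite /glog_char /glog GE -phihE; congr phih.
have -> : gr *m map_mx io (GLval s) *m invmx gr - 1%:M =
    gr *m map_mx io (GLval s - 1%:M) *m invmx gr.
  by rewrite map_mxB map_mx1 mulmxBr mulmxBl mulmx1 mulmxV.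
rewrite tlogJ ?mulVmx // -map_tlog -trace_map_mx map_mxM.
have /congr_subP[x sx] := Ks.
have -> : tlog half (GLval s - 1%:M) = e *: (x - (half * e) *: (x *m x)).
  rewrite sx addrAC subrr add0r /tlog -scalemxAl -scalemxAr scalerBr !scalerA.
  by congr (_ - _ *: _); ring.
move: (x - _) => y; rewrite map_mxZ ioe.
have -> : T *m (gr *m (eh *: map_mx io y) *m invmx gr) =
    gr *m (map_mx io M *m (eh *: map_mx io y)) *m invmx gr.
  rewrite -!(scalemxAr, scalemxAl) !mulmxA 2!scalemxAl -gT.
  by rewrite -2!scalemxAl.
by rewrite mxtrace_mulC !mulmxA mulVmx // mul1mx.
Qed.

End StableChar.

(** * From the inducing data of a super stable character to the Heisenberg data *)

Section IntVal.

Variable F : localField.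

Fact int_val_is_zmod_morphism : zmod_morphism (@int_val F). Proof. by []. Qed.
Fact int_val_is_monoid_morphism : monoid_morphism (@int_val F). Proof. by []. Qed.

HB.instance Definition _ :=
  GRing.isZmodMorphism.Build (integers F) F (@int_val F) int_val_is_zmod_morphism.
HB.instance Definition _ :=
  GRing.isMonoidMorphism.Build (integers F) F (@int_val F) int_val_is_monoid_morphism.

End IntVal.

(** A matrix commuting with [Mbar] is orthogonal to everything, so adding its line to [V] keeps the
    space isotropic. *)
Lemma maximal_isotropic_radical (F : localField) (pi : integers F) (Q : quotients pi) N
    (Mbar X : 'M[resfield Q]_N.-1.+1) V :
  maximal_isotropic Mbar V -> Mbar *m X = X *m Mbar -> X \in V.
Proof.
case=> isoV maxV MX; have X0 Y : commutator_form Mbar X Y = 0.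
  rewrite /commutator_form mulmxBr raddfB /= !mulmxA MX -(mulmxA X).
  by rewrite [\tr (X *m _)]mxtrace_mulC subrr.
have formC Y Z : commutator_form Mbar Y Z = - commutator_form Mbar Z Y.
  by rewrite /commutator_form -(opprB (Z *m Y)) mulmxN raddfN.
have formDl Y Y' Z : commutator_form Mbar (Y + Y') Z =
    commutator_form Mbar Y Z + commutator_form Mbar Y' Z.
  rewrite /commutator_form mulmxDl (mulmxDr Z) opprD addrACA. move: (_ - _) (_ - _) => P P'.
  by rewrite mulmxDr mxtraceD.
have formZl c Y Z : commutator_form Mbar (c *: Y) Z = c * commutator_form Mbar Y Z.
  by rewrite /commutator_form -scalemxAl -scalemxAr -scalerBr -scalemxAr mxtraceZ.
have iso : isotropic Mbar (V + <[X]>).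
  move=> _ _ /memv_addP[v Vv [_ /vlineP[c ->] ->]] /memv_addP[v' Vv' [_ /vlineP[c' ->] ->]].
  rewrite formDl formZl X0 mulr0 addr0 formC formDl formZl X0 mulr0 addr0.
  by rewrite isoV ?oppr0.
rewrite -(maxV _ iso (addvSl _ _)).
by apply: subvP (addvSr V <[X]>) _ (memv_line X).
Qed.

Section PsiHat.

Variables (F : localField) (pi : integers F) (hpi : uniformizer pi).
Variables (Q : quotients pi) (psi : F -> algC).
Hypothesis hpsi : level_zero_character pi psi.
Variables (N l' : nat) (half : integers F).
Hypothesis half2 : half + half = 1.
Local Notation l := l'.+1.
Local Notation r := (l + l')%N.
Local Notation e := (red Q r pi ^+ l').
Variable Mhat : 'M[trunc Q l]_N.-1.+1.

(** The logarithm of [1 + pi^l' X] is [pi^l'] times the matrix in the formula for [theta], which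
    turns [pi^-r] into [pi^-l]. *)
Lemma is_psi_hatE (J : {group {'GL_N[trunc Q r]}}) (theta : 'CF(J)) :
    is_psi_hat psi l' Mhat theta -> J \subset congr_ker Q N r l' ->
  {in J, theta =1 glog_char (red Q r half) (trunc_char psi (r := r)) (stable_lift Mhat)}.
Proof.
move=> theta_psi sJK g Jg; have /congr_subP[x gx] := subsetP sJK _ Jg.
pose X := map_mx (@Defs.lift _ _ Q r) x; pose Mt := map_mx (@Defs.lift _ _ Q l) Mhat.
have XE : map_mx (red Q r) X = x by apply: map_red_lift.
rewrite (theta_psi g Jg Mt X); [|exact: map_red_lift|by rewrite XE].
pose t := \tr (Mt *m (X - (half * pi ^+ l') *: (X *m X))).
have -> : glog_char (red Q r half) (trunc_char psi (r := r)) (stable_lift Mhat) g =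
    trunc_char psi (red Q r (pi ^+ l' * t)).
  rewrite /glog_char /glog gx addrAC subrr add0r; congr trunc_char.
  rewrite rmorphM rmorphXn -trace_map_mx map_mxM map_mxB map_mxZ map_mxM XE.
  rewrite rmorphM rmorphXn -/(stable_lift Mhat) -linearZ /= scalemxAr.
  congr (\tr (_ *m _)); rewrite /tlog -scalemxAl -scalemxAr scalerBr !scalerA.
  by congr (_ - _ *: _); ring.
rewrite trunc_charE // int_valM int_valX.
have -> : int_val pi ^- r * (int_val pi ^+ l' * int_val t) = int_val pi ^- l * int_val t.
  by rewrite mulrA exprD invfM mulfVK // expf_neq0 // (pi_neq0 hpi).
have h2 : int_val half + int_val half = 1 by rewrite -int_valD half2.
have n2 : (2%:R : F) != 0.
  by apply: contra_eq_neq h2 => h0; rewrite -mulr2n -mulr_natl h0 mul0r eq_sym oner_neq0.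
have -> : (2%:R : F)^-1 = int_val half.
  by apply: (mulfI n2); rewrite divff // mulr_natl mulr2n h2.
congr (psi (_ * _)).
by rewrite -trace_map_mx map_mxM map_mxB map_mxZ map_mxM rmorphM rmorphXn.
Qed.

End PsiHat.

Theorem theorem1p2 (F : localField) (pi : integers F) (Q : quotients pi)
    (psi : F -> algC) (p N r l l' : nat)
    (hpi : uniformizer pi)
    (hpsi : level_zero_character pi psi)
    (hp : p \in [pchar resfield Q]) (hp2 : (2 < p)%N)
    (hN : (2 <= N)%N)
    (hl : (2 <= l)%N) (hr : r = (2 * l - 1)%N) (hl' : l' = (l - 1)%N)
    (chi : 'CF('GL_N[trunc Q r]))
    (hchi : chi \in irr 'GL_N[trunc Q r])
    (hstable : super_stable psi l l' chi)
    (sigma : 'CF(congr_ker Q N r l'))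
    (hsigma : sigma \in irr (congr_ker Q N r l'))
    (habove : '['Res[congr_ker Q N r l'] chi, sigma] != 0) :
  exists sigmat : 'CF('I_('GL_N[trunc Q r])[sigma]),
    [/\ sigmat \is a character,
        'Res[congr_ker Q N r l'] sigmat = sigma
      & exists2 rho : 'CF('I_('GL_N[trunc Q r])[sigma] / congr_ker Q N r l'),
          rho \in irr ('I_('GL_N[trunc Q r])[sigma] / congr_ker Q N r l')
        & chi = 'Ind['GL_N[trunc Q r]] (sigmat * (rho %% congr_ker Q N r l')%CF)].
Proof.
have l'0 : (0 < l')%N by lia.
have El : l = l'.+1 by lia.
have Er : r = (l'.+1 + l')%N by lia.
clear hl hr hl'; subst l r.
have [Mhat [stM [J [theta [[sKJ sJK [V maxV JV]] theta_psi nz]]]]] := hstable.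
have [half half2] := integer_half hpi hp hp2.
set r := (l'.+1 + l')%N in chi hchi hstable sigma hsigma habove J theta sKJ sJK JV theta_psi nz *.
pose e := red Q r pi ^+ l'; pose M := stable_lift Mhat.
pose hf := red Q r half; pose phi := trunc_char psi (Q := Q) (r := r).
have r0 : (0 < r)%N by [].
have e3 : e ^+ 3 = 0 by rewrite -exprM red_aX0 //; apply/andP; split; lia.
have hf2 : hf + hf = 1 by rewrite -rmorphD half2 rmorph1.
have phi0 : phi 0 = 1 by apply: (trunc_char0 hpi Q hpsi r0).
have phiD x y : phi (x + y) = phi x * phi y by apply: (trunc_charD hpi hpsi _ _ r0).
have phi_prim y : (forall z, phi (y * z) = 1) -> y = 0.
  exact: (trunc_char_prim hpi hpsi r0).
have [om [omM omE]] := stable_linear_char hpi l'0 hf2 phi0 phiD stM.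
(* ['chi_i] is a constituent of [chi] on [K] lying above [theta]; it need not be [sigma], but
   extending it is enough. *)
have [i /norP[chi_i Ind_i]] : exists i : Iirr (congr_ker Q N r l'),
    ~~ (('['Res[congr_ker Q N r l'] chi, 'chi_i] == 0) ||
        ('['chi_i, 'Ind[congr_ker Q N r l'] theta] == 0)).
  apply/existsP; apply: contraNT nz; rewrite negb_exists => /forallP nz.
  rewrite (cfun_sum_cfdot ('Res chi)) cfdot_suml big1 // => i _; rewrite cfdotZl.
  by have := nz i; rewrite negbK => /orP[/eqP->|/eqP->]; rewrite ?mul0r ?mulr0.
have nsK : (congr_ker Q N r l' <| 'GL_N[trunc Q r])%g.
  by rewrite /normal subsetT congruence_norm.
apply: (irr_Ind_extension nsK hchi (mem_irr i) hsigma chi_i habove).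
have thetaE := is_psi_hatE hpi hpsi half2 theta_psi sJK.
apply: (congruence_extension e3 hf2 phi0 phiD phi_prim (mem_irr i) _ sJK _ omM).
- apply/subsetP=> g /setIP[Sg Kg]; have /congr_subP[x gx] := Kg.
  rewrite (JV g x gx); apply: (maximal_isotropic_radical maxV).
  pose Mt := map_mx (@Defs.lift _ _ Q _) Mhat; pose Xt := map_mx (@Defs.lift _ _ Q _) x.
  have -> : map_mx (@res_red _ _ Q l') (map_mx (@trunc_red _ _ Q _ l') Mhat) =
      map_mx (res Q) Mt.
    by apply/matrixP=> a b; rewrite !mxE /res_red /trunc_red res_red_lift.
  have -> : map_mx (@res_red _ _ Q _) x = map_mx (res Q) Xt.
    by apply/matrixP=> a b; rewrite !mxE.
  rewrite -!map_mxM; apply/eqP; rewrite -subr_eq0 -map_mxB; apply/eqP/matrixP=> a b.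
  (* As [r = 2 l' + 1], being killed by [e ^+ 2] in [O_r] means vanishing in the residue field. *)
  rewrite mxE [RHS]mxE; apply: (@res_scale0 _ _ Q (pi_reg hpi) (l' + l')).
  have : e *: (e *: (M *m x - x *m M)) = 0.
    move: Sg; rewrite inE gx mulmxDl mulmxDr mul1mx mulmx1 !(scalerDr e M).
    rewrite (inj_eq (addrI _)) -scalemxAl -scalemxAr => /eqP E.
    by rewrite scalerBr scalerBr -/e -/M E subrr.
  have xE : x = map_mx (red Q r) Xt by rewrite map_red_lift.
  rewrite [in M *m x]xE [in x *m M]xE -!map_mxM -map_mxB scalerA -exprD.
  by move/matrixP/(_ a b); rewrite !mxE.
(* By Frobenius reciprocity the sum over [J] is a multiple of the inner product with [theta], whose
   values are roots of unity, conjugate to their inverses. *)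
- apply: contraNneq Ind_i => S0; rewrite -cfdot_Res_l cfdotE.
  rewrite [X in _ * X](_ : _ = 0) ?mulr0 // -[RHS]S0; apply: eq_bigr => g Jg.
  rewrite cfResE // thetaE // mulrC; congr (_ * _).
  exact: (trunc_char_conj hpi hpsi _ r0).
- by move=> g; rewrite inE => /andP[Sg Kg]; apply: omE; rewrite inE Sg.
Qed.
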